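(* Let $p_1$ and $p_3$ be odd, and let $p_2$ be an even divisor of both $2p_1$ and $2p_3$. Then $\mathcal{P}(p_1,p_2,p_3)$ is a tight orientably-regular polytope of type $\{p_1,p_2,p_3\}$.
   Context: For such a triple, $\Gamma(p_1,p_2,p_3)$ is the group generated by $x_0,x_1,x_2,x_3$ subject to $x_j^2=1$, $(x_{j-1}x_j)^{p_j}=1$ ($1\le j\le 3$), $(x_jx_k)^2=1$ for $|j-k|\ge 2$, $(x_0x_1x_2x_1x_2)^2=1$ and $(x_3x_2x_1x_2x_1)^2=1$. $\mathcal{P}(p_1,p_2,p_3)$ is the poset built from $\Gamma=\Gamma(p_1,p_2,p_3)$: for $0\le j\le 3$ its $j$-faces are the right cosets of $\Gamma_j=\langle x_k:k\ne j\rangle$, with $\Gamma_j\varphi\le\Gamma_k\psi$ iff $j\le k$ and the cosets intersect, together with a least face of rank $-1$ and a greatest face of rank $4$. An abstract polytope of rank $4$ is a ranked poset (ranks $-1$ to $4$) with unique least and greatest faces, flags of $6$ faces, connected sections and the diamond condition; it has type $\{a,b,c\}$ if its $2$-faces are $a$-gons, the sections between vertices and incident $3$-faces are $b$-gons, and the sections between edges and the greatest face are $c$-gons; it is tight if it has exactly $2abc$ flags; it is regular if its automorphism group is flag-transitive (generated by reflections $\rho_0,\ldots,\rho_3$ relative to a base flag), and orientably-regular if the rotation subgroup $\langle\rho_{j-1}\rho_j\rangle$ has index $2$. *)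

(* Defs.v *)
From Stdlib Require Relation_Operators.
From HB Require Import structures.
From mathcomp Require Import all_boot all_order all_algebra.
From mathcomp Require Import generic_quotient.
From mathcomp Require Import boolp classical_sets functions cardinality.

Set Implicit Arguments.
Unset Strict Implicit.
Unset Printing Implicit Defensive.

Import Order.TTheory GRing.Theory Num.Theory.

Local Open Scope classical_set_scope.
Local Open Scope card_scope.

Section Subgroups.
Local Open Scope group_scope.
Variable G : groupType.

Definition is_subgroup (H : set G) : Prop :=
  H 1 /\ forall x y, H x -> H y -> H (x * y^-1).

Definition gen_subgroup (A : set G) : set G := smallest is_subgroup A.

Definition right_coset (H : set G) (g : G) : set G := [set h * g | h in H].

Definition has_index (H : set G) (n : nat) : Prop :=
  range (right_coset H) #= `I_n.

End Subgroups.

(* The letter [(i, false)] is the generator of index [i], and [(i, true)] is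
   its formal inverse. *)
Definition word (I : Type) := seq (I * bool).

Definition letter (I : Type) (i : I) : word I := [:: (i, false)].

Definition winv (I : Type) (w : word I) : word I :=
  rev [seq (l.1, ~~ l.2) | l <- w].

Definition wpow (I : Type) (w : word I) (n : nat) : word I :=
  flatten (nseq n w).

Section Presentation.
Variables (I : choiceType) (R : set (word I)).

Inductive weq : word I -> word I -> Prop :=
| weq_refl u : weq u u
| weq_sym u v : weq u v -> weq v u
| weq_trans u v w : weq u v -> weq v w -> weq u w
| weq_cancel u v i b : weq (u ++ [:: (i, b); (i, ~~ b)] ++ v) (u ++ v)
| weq_relator u v r : R r -> weq (u ++ r ++ v) (u ++ v).

Definition weqb (u v : seq (I * bool)) : bool := `[< weq u v >].

Lemma weqb_refl : reflexive weqb.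
Proof. by move=> u; apply/asboolP; exact: weq_refl. Qed.

Lemma weqb_sym : symmetric weqb.
Proof. by move=> u v; apply/asboolP/asboolP; exact: weq_sym. Qed.

Lemma weqb_trans : transitive weqb.
Proof.
by move=> v u w /asboolP uv /asboolP vw; apply/asboolP; exact: weq_trans uv vw.
Qed.

Canonical weqb_equiv := EquivRel weqb weqb_refl weqb_sym weqb_trans.

Definition presented := {eq_quot weqb_equiv}%qT.

HB.instance Definition _ := Choice.on presented.

Definition wclass (w : seq (I * bool)) : presented := (\pi_presented w)%qT.

Lemma wclassP u v : wclass u = wclass v <-> weq u v.
Proof.
split=> [/eqP | uv]; last by apply/eqP; rewrite eqmodE; apply/asboolP.
by rewrite eqmodE => /asboolP.
Qed.

Definition pone : presented := wclass [::].
Definition pmul (x y : presented) : presented := wclass (repr x ++ repr y).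
Definition pinv (x : presented) : presented := wclass (winv (repr x)).

Lemma weq_ctx a b u v : weq u v -> weq (a ++ u ++ b) (a ++ v ++ b).
Proof.
elim=> {u v} [u | u v _ | u v w _ uv _ vw | u v i c | u v r Rr].
- exact: weq_refl.
- exact: weq_sym.
- exact: weq_trans uv vw.
- by rewrite -!catA 2![a ++ (u ++ _)]catA; exact: weq_cancel.
- by rewrite -!catA 2![a ++ (u ++ _)]catA; exact: weq_relator.
Qed.

Lemma weq_cat u u' v v' : weq u u' -> weq v v' -> weq (u ++ v) (u' ++ v').
Proof.
move=> uu' vv'; apply: (@weq_trans _ (u' ++ v)).
  exact: (@weq_ctx [::] v).
by have := @weq_ctx u' [::] _ _ vv'; rewrite !cats0.
Qed.

Lemma weq_repr w : weq (repr (wclass w)) w.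
Proof. by apply/wclassP; exact: reprK. Qed.

Lemma pmulE u v : pmul (wclass u) (wclass v) = wclass (u ++ v).
Proof. by apply/wclassP/weq_cat; exact: weq_repr. Qed.

Lemma presentedW (P : presented -> Prop) :
  (forall w, P (wclass w)) -> forall x, P x.
Proof. by move=> Pw x; rewrite -(reprK x); exact: Pw. Qed.

Lemma pmulA : associative pmul.
Proof.
by elim/presentedW=> u; elim/presentedW=> v; elim/presentedW=> w;
  rewrite !pmulE catA.
Qed.

Lemma pmul1 : left_id pone pmul.
Proof. by elim/presentedW=> u; rewrite pmulE. Qed.

Lemma pmulp1 : right_id pone pmul.
Proof. by elim/presentedW=> u; rewrite pmulE cats0. Qed.

Lemma winvK : involutive (@winv I).
Proof.
move=> w; rewrite /winv map_rev revK -map_comp -[RHS]map_id.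
by apply: eq_map => -[i b] /=; rewrite negbK.
Qed.

Lemma weq_winvr w : weq (w ++ winv w) [::].
Proof.
elim: w => [|[i b] w IH]; first exact: weq_refl.
rewrite /winv /= rev_cons -cats1 -/(winv w).
apply: (@weq_trans _ ([:: (i, b)] ++ [:: (i, ~~ b)])).
  by have := @weq_ctx [:: (i, b)] [:: (i, ~~ b)] _ _ IH; rewrite -!catA.
exact: (@weq_cancel [::] [::]).
Qed.

Lemma weq_winvl w : weq (winv w ++ w) [::].
Proof. by rewrite -{2}(winvK w); exact: weq_winvr. Qed.

Lemma pmulV : left_inverse pone pinv pmul.
Proof.
move=> x; rewrite -{2}(reprK x) /pinv -/(wclass _) pmulE.
by apply/wclassP; exact: weq_winvl.
Qed.

Lemma pmulpV : right_inverse pone pinv pmul.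
Proof.
move=> x; rewrite -{1}(reprK x) /pinv -/(wclass _) pmulE.
by apply/wclassP; exact: weq_winvr.
Qed.

HB.instance Definition _ :=
  isGroup.Build presented pmulA pmul1 pmulp1 pmulV pmulpV.

End Presentation.

Section Polytopes.
Local Open Scope ring_scope.

Section Faces.
Variables (T : Type) (le : T -> T -> Prop) (rk : T -> int).

Definition lt (F G : T) : Prop := le F G /\ F <> G.

Definition chain (C : set T) : Prop :=
  forall F G, C F -> C G -> le F G \/ le G F.

Definition flag (C : set T) : Prop :=
  chain C /\ forall D, chain D -> C `<=` D -> D = C.

(* The faces strictly between [F] and [G], i.e. the proper faces of the
   section [G/F]. *)
Definition between (F G : T) : set T := [set H | lt F H /\ lt H G].

Definition incident_in (A : set T) (H K : T) : Prop :=
  [/\ A H, A K & le H K \/ le K H].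

Definition section_connected (F G : T) : Prop :=
  forall H K, between F G H -> between F G K ->
    Relation_Operators.clos_refl_trans T (incident_in (between F G)) H K.

(* The section [G/F] has rank [rk G - rk F - 1]; connectedness is only a
   condition on sections of rank at least 2. *)
Record is_polytope (n : nat) : Prop := {
  poly_refl : forall F, le F F;
  poly_anti : forall F G, le F G -> le G F -> F = G;
  poly_trans : forall F G H, le F G -> le G H -> le F H;
  poly_rank : forall F, -1 <= rk F <= n%:Z;
  poly_rank_lt : forall F G, lt F G -> rk F < rk G;
  poly_least : exists F, forall G, le F G;
  poly_greatest : exists F, forall G, le G F;
  poly_flag : forall C, flag C -> C #= `I_(n + 2);
  poly_connected : forall F G, le F G -> 2 <= rk G - rk F - 1 ->
    section_connected F G;
  poly_diamond : forall F G, le F G -> rk G - rk F = 2 ->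
    between F G #= `I_2
}.

Definition section (F G : T) := {H : T | le F H /\ le H G}.

Definition section_le (F G : T) (H K : section F G) : Prop :=
  le (sval H) (sval K).

Definition section_rk (F G : T) (H : section F G) : int :=
  rk (sval H) - rk F - 1.

End Faces.

Definition is_polygon (a : nat) (T : Type) (le : T -> T -> Prop)
    (rk : T -> int) : Prop :=
  is_polytope le rk 2 /\ [set F | rk F = 0] #= `I_a.

(* For [n = 4] and [i = 1, 2, 3] these are the 2-faces, the sections between
   vertices and 3-faces, and the sections between edges and the greatest face. *)
Definition has_gons (T : Type) (le : T -> T -> Prop) (rk : T -> int)
    (i : int) (a : nat) : Prop :=
  forall F G, le F G -> rk F = i - 2 -> rk G = i + 1 ->
    is_polygon a (@section_le T le F G) (@section_rk T le rk F G).

Definition has_type3 (T : Type) (le : T -> T -> Prop) (rk : T -> int)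
    (a b c : nat) : Prop :=
  [/\ has_gons le rk 1 a, has_gons le rk 2 b & has_gons le rk 3 c].

Definition is_tight3 (T : Type) (le : T -> T -> Prop) (a b c : nat) : Prop :=
  [set C | flag le C] #= `I_(2 * a * b * c).

Record aut (T : Type) (le : T -> T -> Prop) := Aut {
  aut_fun :> T -> T;
  aut_inv : T -> T;
  aut_funK : cancel aut_fun aut_inv;
  aut_invK : cancel aut_inv aut_fun;
  aut_le : forall F G, le (aut_fun F) (aut_fun G) <-> le F G
}.

Section AutGroup.
Variables (T : Type) (le : T -> T -> Prop).
Implicit Types a b c : aut le.

Lemma autP a b : a =1 b -> a = b.
Proof.
case: a b => [f f' fK f'K fP] [g g' gK g'K gP] /= fg.
have {}fg : f = g by apply/funext.
subst g; have gf' : f' = g' by apply/funext => F; rewrite -{1}(g'K F) fK.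
by subst g'; congr Aut; exact: Prop_irrelevance.
Qed.

HB.instance Definition _ := gen_eqMixin (aut le).
HB.instance Definition _ := gen_choiceMixin (aut le).

Definition aut_one : aut le :=
  @Aut T le idfun idfun (fun=> erefl) (fun=> erefl) (fun _ _ => iff_refl _).

Lemma aut_mul_le a b F G : le (b (a F)) (b (a G)) <-> le F G.
Proof. by split=> [/aut_le/aut_le | FG]; last by do 2!apply/aut_le. Qed.

(* Automorphisms act on the right: [a * b] is [a] followed by [b], as for
   [{perm T}]. *)
Definition aut_mul a b : aut le :=
  @Aut T le (b \o a) (aut_inv a \o aut_inv b)
    (can_comp (aut_funK b) (aut_funK a)) (can_comp (aut_invK a) (aut_invK b))
    (aut_mul_le a b).

Lemma aut_opp_le a F G : le (aut_inv a F) (aut_inv a G) <-> le F G.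
Proof. by rewrite -(aut_le a) !aut_invK. Qed.

Definition aut_opp a : aut le :=
  @Aut T le (aut_inv a) a (aut_invK a) (aut_funK a) (aut_opp_le a).

Lemma aut_mulA : associative aut_mul.
Proof. by move=> a b c; apply: autP. Qed.

Lemma aut_mul1 : left_id aut_one aut_mul.
Proof. by move=> a; apply: autP. Qed.

Lemma aut_mulp1 : right_id aut_one aut_mul.
Proof. by move=> a; apply: autP. Qed.

Lemma aut_mulV : left_inverse aut_one aut_opp aut_mul.
Proof. by move=> a; apply: autP => F /=; rewrite aut_invK. Qed.

Lemma aut_mulpV : right_inverse aut_one aut_opp aut_mul.
Proof. by move=> a; apply: autP => F /=; rewrite aut_funK. Qed.

HB.instance Definition _ :=
  isGroup.Build (aut le) aut_mulA aut_mul1 aut_mulp1 aut_mulV aut_mulpV.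

Definition is_regular : Prop :=
  forall C D, flag le C -> flag le D -> exists a : aut le, a @` C = D.

End AutGroup.

Section Orientable.
Variables (T : Type) (le : T -> T -> Prop) (rk : T -> int).

Definition adjacent (j : nat) (C D : set T) : Prop :=
  [/\ flag le C, flag le D, C <> D &
      forall F, rk F <> j%:Z -> (C F <-> D F)].

Definition is_reflection (C : set T) (j : nat) (r : aut le) : Prop :=
  adjacent j C (r @` C).

Definition rotation_subgroup (n : nat) (r : 'I_n -> aut le) : set (aut le) :=
  gen_subgroup
    [set g | exists i j : 'I_n, j = i.+1 :> nat /\ g = (r i * r j)%g].

Definition is_orientably_regular (n : nat) : Prop :=
  is_regular le /\
  forall C, flag le C -> exists r : 'I_n -> aut le,
    [/\ forall j : 'I_n, is_reflection C j (r j),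
        gen_subgroup (range r) = setT
      & has_index (rotation_subgroup r) 2].

End Orientable.
End Polytopes.

Section CosetPoset.
Local Open Scope ring_scope.
Variables (G : groupType) (n : nat) (x : 'I_n -> G).

(* [Gamma_j]: generated by the [x k] with [k <> j]. *)
Definition stab (j : 'I_n) : set G := gen_subgroup [set x k | k in [set~ j]].

(* The rank is part of the data: cosets of different [stab j] may coincide as
   sets, but they are different faces. *)
Record coset_face := CosetFace {
  cf_rank : 'I_n;
  cf_set : set G;
  cf_setP : exists g, cf_set = right_coset (stab cf_rank) g
}.

Inductive face := Least | Proper of coset_face | Greatest.

Definition face_le (F F' : face) : Prop :=
  match F, F' with
  | Least, _ => True
  | _, Greatest => True
  | Proper A, Proper B =>
      (cf_rank A <= cf_rank B)%N /\ (cf_set A `&` cf_set B) !=set0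
  | _, _ => False
  end.

Definition face_rk (F : face) : int :=
  match F with
  | Least => -1
  | Proper A => (cf_rank A : nat)%:Z
  | Greatest => n%:Z
  end.

End CosetPoset.

Definition xw (k : nat) : word 'I_4 := letter (inord k).

Section Gamma.
Variables p1 p2 p3 : nat.

Inductive Gamma_relator : word 'I_4 -> Prop :=
| Gamma_invol (j : 'I_4) : Gamma_relator (wpow (letter j) 2)
| Gamma_p1 : Gamma_relator (wpow (xw 0 ++ xw 1) p1)
| Gamma_p2 : Gamma_relator (wpow (xw 1 ++ xw 2) p2)
| Gamma_p3 : Gamma_relator (wpow (xw 2 ++ xw 3) p3)
| Gamma_comm (j k : 'I_4) : (j + 2 <= k) || (k + 2 <= j) ->
    Gamma_relator (wpow (letter j ++ letter k) 2)
| Gamma_left : Gamma_relator (wpow (xw 0 ++ xw 1 ++ xw 2 ++ xw 1 ++ xw 2) 2)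
| Gamma_right : Gamma_relator (wpow (xw 3 ++ xw 2 ++ xw 1 ++ xw 2 ++ xw 1) 2).

Definition Gamma := presented Gamma_relator.

HB.instance Definition _ := Group.on Gamma.

Definition Gamma_gen (j : 'I_4) : Gamma := wclass Gamma_relator (letter j).

Definition coset_poset := face Gamma_gen.
Definition coset_poset_le : coset_poset -> coset_poset -> Prop := @face_le _ _ Gamma_gen.
Definition coset_poset_rk : coset_poset -> int := @face_rk _ _ Gamma_gen.

End Gamma.

(* Main.v *)
(* Write p2 = 2q; q is odd and divides p1 and p3. In Gamma every generator
   inverts w = (x1 x2)^2, so <w> is normal of order dividing q, and modulo w the
   group is a quotient of the product of the dihedral groups <x0, x1> and
   <x2, x3>. Hence every element has the form
     (x0 x1)^X x1^e w^k (x3 x2)^Y x2^f,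
   and |Gamma| <= 4 p1 p3 q = 2 p1 p2 p3. Gamma acts on explicit coordinates (a
   Heisenberg group over Z/q, extended by two reflections), which shows that
   these normal forms are distinct, computes the intersections of the subgroups
   Gamma_j, and gives the orientation character. So Gamma is a string C-group
   of order 2 p1 p2 p3, and for a string C-group the coset poset is a regular
   polytope: its flags are the sets {Gamma_j g | j} for g in Gamma, all its
   automorphisms are right translations, and sections are controlled by
   the intersection of Gamma_i and Gamma_j being generated by the x_k with
   k <> i, j. *)
Require Import Defs.
From mathcomp Require Import all_boot.
From mathcomp Require Import all_order all_algebra.
From mathcomp Require Import boolp classical_sets functions cardinality.
From mathcomp Require Import zify ring.

Set Implicit Arguments.
Unset Strict Implicit.
Unset Printing Implicit Defensive.

Import Order.TTheory GRing.Theory Num.Theory.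

Local Open Scope classical_set_scope.
Local Open Scope card_scope.

(** * Subgroups generated by involutions *)

Section GeneratedSubgroup.
Local Open Scope group_scope.
Variable G : groupType.
Implicit Types (A B : set G) (g h : G).

(** The relations bound the order of [Gamma] only from above; the lower bound needs a model, and the
    relations dictate it. Every generator inverts w, so w commutes with [x0 x1] and [x3 x2]; moving
    commuting generators past each other turns the commutator of these two into [x0 x3 w x0 x3],
    which is w. They are thus two translations with central commutator w: the Heisenberg relation.
    Its bilinear term mixes a coordinate modulo p1 with one modulo p3, so the centre is taken modulo
    q, a common divisor of both. In the model w shifts the central coordinate by 2, and it is the
    oddness of q that gives w order exactly q. On the polytope side, a face is treated as a rank
    together with a representative in the group. Incidence then means having a common
    representative, and all the order theory rests on one fact: the faces of a chain have a
    representative common to all of them. *)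

Lemma gen_subgroup1 A : gen_subgroup A 1.
Proof. by move=> H [[]]. Qed.

Lemma gen_subgroup_divg A g h :
  gen_subgroup A g -> gen_subgroup A h -> gen_subgroup A (g * h^-1).
Proof. by move=> Ag Ah H HA; apply: HA.1.2; [exact: Ag | exact: Ah]. Qed.

Lemma gen_subgroupV A g : gen_subgroup A g -> gen_subgroup A g^-1.
Proof.
by move=> Ag; have := gen_subgroup_divg (@gen_subgroup1 A) Ag; rewrite mul1g.
Qed.

Lemma gen_subgroupM A g h :
  gen_subgroup A g -> gen_subgroup A h -> gen_subgroup A (g * h).
Proof.
move=> Ag Ah; rewrite -[h]invgK.
by apply: gen_subgroup_divg => //; exact: gen_subgroupV.
Qed.

Lemma gen_subgroupX A g n : gen_subgroup A g -> gen_subgroup A (g ^+ n).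
Proof.
move=> Ag; elim: n => [|n IH]; first exact: gen_subgroup1.
by rewrite expgS; exact: gen_subgroupM.
Qed.

Lemma gen_subgroup_sub A : A `<=` gen_subgroup A.
Proof. by move=> g Ag H [_]; apply. Qed.

Lemma gen_subgroup_min A H : is_subgroup H -> A `<=` H -> gen_subgroup A `<=` H.
Proof. by move=> sH AH g; apply. Qed.

Lemma gen_subgroup_mono A B : A `<=` B -> gen_subgroup A `<=` gen_subgroup B.
Proof. by move=> AB g Ag H [sH BH]; apply: Ag; split=> // a /AB /BH. Qed.

End GeneratedSubgroup.

Section Involutions.
Local Open Scope group_scope.
Variables (G : groupType) (I : Type) (x : I -> G).
Hypothesis xx : forall i, x i * x i = 1.

Lemma invol_inv i : (x i)^-1 = x i.
Proof. by apply: mulg1_eq. Qed.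

Lemma invol_mulK i g : x i * (x i * g) = g.
Proof. by rewrite mulgA xx mul1g. Qed.

(** The generators are their own inverses, so positive words already exhaust the subgroup, and left
    multiplication by a generator is the only induction step. *)
Lemma invol_gen_ind (D : set I) (P : G -> Prop) :
    P 1 ->
    (forall i g, D i -> gen_subgroup (x @` D) g -> P g -> P (x i * g)) ->
  forall g, gen_subgroup (x @` D) g -> P g.
Proof.
move=> P1 PS.
pose word g := exists2 s : seq I, foldr (fun i Q => D i /\ Q) True s &
  g = foldr (fun i h => x i * h) 1 s.
have wordS i g : D i -> word g -> word (x i * g).
  by move=> Di [s Ds ->]; exists (i :: s).
have wordM g h : word g -> word h -> word (g * h).
  move=> [s Ds ->]; elim: s Ds => [|i s IH] /=; first by rewrite mul1g.
  by move=> [Di Ds] wh; rewrite -mulgA; apply: wordS => //; exact: IH.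
have word1 : word 1 by exists [::].
have wordV g : word g -> word g^-1.
  move=> [s Ds ->]; elim: s Ds => [|i s IH] /=; first by rewrite invg1.
  move=> [Di Ds]; rewrite invgM invol_inv; apply: wordM; first exact: IH.
  by rewrite -[x i]mulg1; exact: wordS.
have genw g : gen_subgroup (x @` D) g -> word g.
  apply: gen_subgroup_min; first by split=> // u v wu wv; apply: wordM; auto.
  by move=> _ [i Di <-]; rewrite -[x i]mulg1; exact: wordS.
move=> g /genw [s Ds ->].
suff [] : gen_subgroup (x @` D) (foldr (fun i h => x i * h) 1 s) /\
  P (foldr (fun i h => x i * h) 1 s) by [].
elim: s Ds => [|i s IH] /=; first by split=> //; exact: gen_subgroup1.
move=> [Di /IH [gs Ps]]; split; last exact: PS.
by apply: gen_subgroupM => //; apply: gen_subgroup_sub; exists i.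
Qed.

Lemma commuting_gen_factor (D E : set I) :
    (forall i j, D i -> E j -> x i * x j = x j * x i) ->
  forall g, gen_subgroup (x @` (D `|` E)) g ->
  exists u v, [/\ gen_subgroup (x @` D) u, gen_subgroup (x @` E) v & g = u * v].
Proof.
move=> DE; apply: invol_gen_ind.
  by exists 1, 1; rewrite mulg1; split=> //; exact: gen_subgroup1.
move=> i g DEi _ [u [v [Du Ev ->]]].
case: DEi => [Di|Ei].
  exists (x i * u), v; rewrite mulgA; split=> //.
  by apply: gen_subgroupM => //; apply: gen_subgroup_sub; exists i.
exists u, (x i * v); split=> //.
  by apply: gen_subgroupM => //; apply: gen_subgroup_sub; exists i.
rewrite !mulgA; congr (_ * _); move: u Du; apply: invol_gen_ind.
  by rewrite mulg1 mul1g.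
by move=> j u Dj _ IH; rewrite mulgA -DE // -mulgA IH mulgA.
Qed.

End Involutions.

(** * Dihedral subgroups and their normal forms *)

Section Dihedral.
Local Open Scope group_scope.
Variable G : groupType.

Lemma expg_modn (s : G) p k : s ^+ p = 1 -> s ^+ (k %% p) = s ^+ k.
Proof.
move=> sp; rewrite [in RHS](divn_eq k p) expgnDr mulnC expgnA sp.
by rewrite expg1n mul1g.
Qed.

Lemma invol_mul_expgV (y z : G) : y * y = 1 -> z * z = 1 ->
  forall k, ((y * z) ^+ k)^-1 = (z * y) ^+ k.
Proof.
move=> yy zz k; apply: mulg1_eq; elim: k => [|k IH]; first exact: mulg1.
rewrite expgS expgSr -mulgA [_ ^+ k * (_ * _)]mulgA IH mul1g.
by rewrite -mulgA [z * (_ * _)]mulgA zz mul1g.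
Qed.

Lemma invol_pow_swap (y z : G) : y * y = 1 -> z * z = 1 ->
  forall k, y * (y * z) ^+ k = (z * y) ^+ k * y.
Proof.
move=> yy zz; elim=> [|k IH]; first by rewrite mulg1 mul1g.
rewrite expgSr mulgA IH [in RHS]expgSr -!mulgA yy [y * (y * z)]mulgA yy.
by rewrite mul1g mulg1.
Qed.

Lemma dihedral_form (I : Type) (x : I -> G) (i j : I) p :
    (forall k, x k * x k = 1) -> 0 < p -> (x i * x j) ^+ p = 1 ->
  forall g, gen_subgroup (x @` [set i; j]) g ->
  exists k (e : bool), g = (x i * x j) ^+ k * x j ^+ e.
Proof.
move=> xx p0 ijp.
(* [p.-1] stands for -1 modulo [p], which keeps the exponents natural numbers. *)
have rotV k : (x j * x i) ^+ k = (x i * x j) ^+ (p.-1 * k).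
  rewrite -[LHS]invol_mul_expgV ?xx //.
  apply: mulg1_eq; rewrite -expgnDr -{1}[k]mul1n -mulnDl add1n prednK //.
  by rewrite expgnA ijp expg1n.
apply: (invol_gen_ind xx).
  by exists 0, false; rewrite mulg1.
move=> _ g [->|->] _ [k [e ->]].
  exists (p.-1 * k)%N.+1, (~~ e).
  rewrite mulgA invol_pow_swap ?xx // rotV expgSr -!mulgA; congr (_ * _).
  by case: e; rewrite /= ?expg1 ?expg0 ?xx // mulg1.
exists (p.-1 * k)%N, (~~ e); rewrite -rotV.
have -> : x j * ((x i * x j) ^+ k * x j ^+ e) =
          x j * (x i * x j) ^+ k * x j ^+ e by rewrite mulgA.
have -> : x j * (x i * x j) ^+ k = (x j * x i) ^+ k * x j.
  elim: k => [|k IH]; first by rewrite mulg1 mul1g.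
  by rewrite expgSr mulgA IH [in RHS]expgSr -!mulgA.
by rewrite -mulgA; congr (_ * _); case: e; rewrite /= ?expg1 ?expg0 ?xx ?mulg1.
Qed.

End Dihedral.

(** * Coset posets of string C-groups *)

Section RightCosets.
Local Open Scope group_scope.
Variables (G : groupType) (A : set G).

Lemma right_coset_mem g h :
  right_coset (gen_subgroup A) g h <-> gen_subgroup A (h * g^-1).
Proof.
split=> [[u Au <-]|Ahg]; first by rewrite mulgK.
by exists (h * g^-1) => //; rewrite mulgVK.
Qed.

Lemma right_coset_eq g h :
  right_coset (gen_subgroup A) g = right_coset (gen_subgroup A) h <->
  gen_subgroup A (g * h^-1).
Proof.
split=> [gh|Agh].
  by apply/right_coset_mem; rewrite -gh; apply/right_coset_mem;
    rewrite mulgV; exact: gen_subgroup1.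
apply/seteqP; split=> u /right_coset_mem Au; apply/right_coset_mem.
  by rewrite -[u](mulgVK g) -mulgA; exact: gen_subgroupM.
rewrite -[u](mulgVK h) -mulgA; apply: gen_subgroupM => //.
by have := gen_subgroupV Agh; rewrite invgF.
Qed.

End RightCosets.

Section StringCGroup.
Local Open Scope ring_scope.
Local Open Scope group_scope.
Variables (G : groupType) (n : nat) (x : 'I_n -> G).

(** The intersection condition is stated for two maximal subgroups, which is what two incident faces
    see. It gives connectedness and the diamond condition; [sc_notin] makes adjacent flags
    different, and [sc_core] makes an element recoverable from its flag. *)
Record string_C_group : Prop := StringCGroup {
  sc_invol : forall i, x i * x i = 1;
  sc_comm : forall i j : 'I_n, (i.+1 < j)%N -> x i * x j = x j * x i;
  sc_gen : gen_subgroup (range x) = setT;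
  sc_inter : forall i j : 'I_n, (i < j)%N ->
    stab x i `&` stab x j `<=` gen_subgroup (x @` [set k | k <> i /\ k <> j]);
  sc_notin : forall i, ~ stab x i (x i);
  sc_core : forall g, (forall i, stab x i g) -> g = 1
}.

(* Ranks outside [0, n - 1] are allowed, so that the least and greatest faces,
   whose "cosets" are [G] itself, need no separate treatment. *)
Definition istab (r : int) : set G :=
  gen_subgroup (x @` [set k : 'I_n | (k : nat)%:Z <> r]).

Definition coset_at (i : 'I_n) (g : G) : coset_face x :=
  @CosetFace _ _ x i (right_coset (stab x i) g) (ex_intro _ g erefl).

Definition face_at (r : int) (g : G) : face x :=
  match r with
  | Posz m => if insub m is Some i then Proper (coset_at i g) else Greatest x
  | Negz _ => Least x
  end.

Arguments face_at : simpl never.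

Lemma stab_istab (i : 'I_n) : stab x i = istab (i : nat)%:Z.
Proof.
rewrite /stab /istab; congr (gen_subgroup (_ @` _)).
apply/seteqP; split=> k /= ki; first by move=> [] /ord_inj.
by move=> kj; apply: ki; rewrite kj.
Qed.

Lemma istab_gen (i : 'I_n) r : (i : nat)%:Z <> r -> istab r (x i).
Proof. by move=> ir; apply: gen_subgroup_sub; exists i. Qed.

Lemma face_at_cases r :
  [\/ (r < 0)%R /\ (forall g, face_at r g = Least x),
      exists2 i : 'I_n, r = (i : nat)%:Z &
        forall g, face_at r g = Proper (coset_at i g)
    | (n%:Z <= r)%R /\ (forall g, face_at r g = Greatest x)].
Proof.
case: r => m; last by apply: Or31; split.
have [mn|nm] := ltnP m n.
  apply: Or32; exists (Ordinal mn) => // g.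
  by rewrite /face_at insubT.
apply: Or33; split; first by rewrite lez_nat.
by move=> g; rewrite /face_at insubN // -leqNgt.
Qed.

Lemma face_at_rk r g : (-1 <= r <= n%:Z)%R -> face_rk (face_at r g) = r.
Proof.
move=> rn; have [[r0 ->] /=|[i ri ->] //|[r0 ->] /=] := face_at_cases r; lia.
Qed.

Lemma face_at_ord (i : 'I_n) g : face_at (i : nat)%:Z g = Proper (coset_at i g).
Proof. by rewrite /face_at valK. Qed.

Lemma face_at_least g : face_at (-1) g = Least x.
Proof. by []. Qed.

Lemma face_at_greatest g : face_at n%:Z g = Greatest x.
Proof. by rewrite /face_at insubN // ltnn. Qed.

Lemma face_rk_bounds (F : face x) : (-1 <= face_rk F <= n%:Z)%R.
Proof. by case: F => [|[i A ?]|] /=; [|have := ltn_ord i|]; lia. Qed.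

Lemma coset_face_ext (i : 'I_n) (A B : set G) pA pB : A = B ->
  @CosetFace _ _ x i A pA = @CosetFace _ _ x i B pB.
Proof. by move=> AB; subst B; congr CosetFace; exact: Prop_irrelevance. Qed.

Lemma faceP (F : face x) : exists g, F = face_at (face_rk F) g.
Proof.
case: F => [|[i A Ag]|]; [by exists 1| |exists 1; exact: esym (face_at_greatest 1)].
case: (Ag) => g Eg; exists g; rewrite /= face_at_ord /coset_at; congr Proper.
exact: coset_face_ext.
Qed.

Hypothesis C : string_C_group.
Let xx := sc_invol C.

Lemma istab_out r g : (r < 0)%R \/ (n%:Z <= r)%R -> istab r g.
Proof.
move=> rout; have: gen_subgroup (range x) g by rewrite sc_gen.
apply: gen_subgroup_mono => _ [i _ <-]; exists i => //= ir.
by have := ltn_ord i; lia.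
Qed.

Lemma face_at_eq r g h : face_at r g = face_at r h <-> istab r (g * h^-1).
Proof.
have [[r0 rE]|[i ri rE]|[r0 rE]] := face_at_cases r; rewrite !rE.
- by split=> // _; apply: istab_out; left.
- rewrite ri -stab_istab; apply: iff_trans (right_coset_eq _ _ _).
  split=> [[]//|E].
  by rewrite /coset_at; congr Proper; exact: coset_face_ext.
- by split=> // _; apply: istab_out; right.
Qed.

Lemma face_at_mull r u g : istab r u -> face_at r (u * g) = face_at r g.
Proof. by move=> ru; apply/face_at_eq; rewrite mulgK. Qed.

(** Any element of the intersection of two cosets represents both of them. *)
Lemma face_leP (F F' : face x) : face_le F F' <->
  (face_rk F <= face_rk F')%R /\
  exists g, F = face_at (face_rk F) g /\ F' = face_at (face_rk F') g.
Proof.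
split=> [FF'|].
  case: F F' FF' => [|A|] [|B|] //=.
  - by move=> _; split=> //; exists 1.
  - move=> _; split; first by lia.
    by have [g Eg] := faceP (Proper B); exists g; rewrite face_at_least.
  - by move=> _; split=> //; exists 1; rewrite face_at_least face_at_greatest.
  - move=> [AB [g [Ag Bg]]]; split; first by rewrite lez_nat.
    exists g; have [a Ea] := faceP (Proper A); have [b Eb] := faceP (Proper B).
    rewrite /= in Ea Eb.
    split; rewrite ?Ea ?Eb; apply/face_at_eq; rewrite -stab_istab.
      move: Ea Ag; rewrite face_at_ord => -[] {1}-> /=.
      by move=> /right_coset_mem /gen_subgroupV; rewrite invgF.
    move: Eb Bg; rewrite face_at_ord => -[] {1}-> /=.
    by move=> /right_coset_mem /gen_subgroupV; rewrite invgF.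
  - move=> _; split; first by have := ltn_ord (cf_rank A); lia.
    by have [g Eg] := faceP (Proper A); exists g; rewrite face_at_greatest.
  - by move=> _; split=> //; exists 1; rewrite face_at_greatest.
move=> [r [g [-> ->]]]; move: r.
case: F F' => [|A|] [|B|] //=; rewrite ?face_at_ord ?face_at_greatest //=.
- move=> AB; split; first by lia.
  exists g; split; apply/right_coset_mem; rewrite mulgV; exact: gen_subgroup1.
- by have := ltn_ord (cf_rank B); lia.
Qed.

Lemma face_le_at r s g : (-1 <= r)%R -> (r <= s)%R -> (s <= n%:Z)%R ->
  face_le (face_at r g) (face_at s g).
Proof.
move=> r1 rs sn; apply/face_leP.
by rewrite !face_at_rk; try lia; split=> //; exists g.
Qed.

(* An element of [istab r] is a product of generators of index below [r] and
   above [r]: the former can be absorbed by a face of rank [>= r], the latter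
   by faces of rank [<= r]. *)
Lemma istab_factor r g : istab r g ->
  exists u v, [/\ forall s, (r <= s)%R -> istab s u,
    forall s, (s <= r)%R -> istab s v & g = u * v].
Proof.
pose D := [set k : 'I_n | ((k : nat)%:Z < r)%R].
pose E := [set k : 'I_n | (r < (k : nat)%:Z)%R].
have -> : istab r = gen_subgroup (x @` (D `|` E)).
  rewrite /istab; congr (gen_subgroup (_ @` _)).
  by apply/seteqP; split=> k; rewrite /D /E /=; lia.
have DE (i j : 'I_n) : D i -> E j -> x i * x j = x j * x i.
  by rewrite /D /E /= => ir rj; apply: (sc_comm C); lia.
move=> /(commuting_gen_factor xx DE) [u [v [Du Ev ->]]].
exists u, v; split=> // s rs.
  by apply: gen_subgroup_mono Du => _ [k + <-] => kr; exists k => //=;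
    move: kr; rewrite /D /=; lia.
by apply: gen_subgroup_mono Ev => _ [k + <-] => kr; exists k => //=;
  move: kr; rewrite /E /=; lia.
Qed.

Lemma istab_inter r s : (-1 <= r)%R -> (r < s)%R -> (s <= n%:Z)%R ->
  istab r `&` istab s `<=`
  gen_subgroup (x @` [set k : 'I_n | (k : nat)%:Z <> r /\ (k : nat)%:Z <> s]).
Proof.
move=> r1 rs sn g [rg sg].
have [r0|r0] := ltP r 0%R.
  apply: gen_subgroup_mono sg => _ [k ks <-]; exists k => //; split=> // kr.
  by lia.
have [s0|s0] := leP n%:Z s.
  apply: gen_subgroup_mono rg => _ [k ks <-]; exists k => //; split=> // kr.
  by have := ltn_ord k; lia.
have [i ri] : exists i : 'I_n, r = (i : nat)%:Z.
  by have rn : (`|r| < n)%N by [lia]; exists (Ordinal rn) => /=; lia.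
have [j sj] : exists i : 'I_n, s = (i : nat)%:Z.
  by have rn : (`|s| < n)%N by [lia]; exists (Ordinal rn) => /=; lia.
have := sc_inter C (i := i) (j := j); rewrite !stab_istab -ri -sj => ijI.
have := ijI _ _ (conj rg sg) => /(_ ltac:(lia)).
apply: gen_subgroup_mono => _ [k [ki kj] <-]; exists k => //.
by rewrite /= ri sj; split=> -[] /ord_inj.
Qed.
End StringCGroup.

Arguments face_at {G n} x r g : simpl never.

Lemma card_eq_enum (T : Type) (A : set T) (p : nat) (f : nat -> T) :
    (forall k, k < p -> A (f k)) ->
    (forall t, A t -> exists2 k, k < p & t = f k) ->
    (forall k l, k < p -> l < p -> f k = f l -> k = l) ->
  A #= `I_p.
Proof.
move=> fA Af f_inj.
have -> : A = f @` `I_p.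
  apply/seteqP; split=> [t /Af[k kp ->]|_ [k /= kp <-]]; last exact: fA.
  by exists k.
by apply: inj_card_eq => k l; rewrite !inE; exact: f_inj.
Qed.

(** * Chains and common representatives *)

Section Chains.
Local Open Scope ring_scope.
Local Open Scope group_scope.
Variables (G : groupType) (n : nat) (x : 'I_n -> G).
Hypothesis C : string_C_group x.

Lemma face_le_rk (F F' : face x) : face_le F F' -> (face_rk F <= face_rk F')%R.
Proof. by case/(face_leP C). Qed.

Lemma face_le_rk_eq (F F' : face x) :
  face_le F F' -> face_rk F = face_rk F' -> F = F'.
Proof. by case/(face_leP C)=> _ [g [Fg F'g]] E; rewrite Fg F'g E. Qed.

Lemma face_le_on (F F' : face x) g :
    F = face_at x (face_rk F) g -> F' = face_at x (face_rk F') g ->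
  (face_rk F <= face_rk F')%R -> face_le F F'.
Proof. by move=> Fg F'g FF'; apply/(face_leP C); split=> //; exists g. Qed.

Lemma face_le_refl (F : face x) : face_le F F.
Proof. by have [g Fg] := faceP F; exact: (face_le_on Fg Fg (lexx _)). Qed.

(** Induction on rank: [g] represents the members of rank below [m], these have rank at most [r],
    and the other members lie above the face of rank [r] on [g]. A member of rank [m] shares some
    representative [v] with that face. Splitting [v * g^-1] as [u * w] at rank [r] gives
    [w * g = u^-1 * v]: faces of rank at most [r] absorb [w] and those of rank at least [r] absorb
    [u], so [w * g] represents the old members and the new one. *)
Lemma chain_common_element (A : set (face x)) : chain (@face_le _ _ x) A ->
  exists g, forall F, A F -> F = face_at x (face_rk F) g.
Proof.
move=> chA.
suff P m : (m <= n.+1)%N -> exists (r : int) g,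
    [/\ (-1 <= r < m%:Z)%R, (r <= n%:Z)%R &
    forall F, A F ->
      if (face_rk F < m%:Z)%R
      then (face_rk F <= r)%R /\ F = face_at x (face_rk F) g
      else face_le (face_at x r g) F].
  have [r [g [_ _ Pg]]] := P n.+1 (leqnn _).
  exists g => F /Pg; case: ifP; first by move=> _ [].
  by have := face_rk_bounds F; lia.
elim: m => [_|m IH mn].
  exists (-1)%R, 1; split; [lia|lia|] => F _.
  case: ifP => [F0|_]; last by [].
  have FE : face_rk F = (-1)%R by have := face_rk_bounds F; lia.
  by split; [rewrite FE|have [g ->] := faceP F; rewrite FE].
have [r [g [rm rn Pg]]] := IH (ltnW mn).
have [[F [AF Fm]]|noF] := pselect (exists F, A F /\ face_rk F = m%:Z); last first.
  exists r, g; split; [lia|lia|] => F AF; have := Pg _ AF.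
  have Fm : face_rk F <> m%:Z by move=> Fm; apply: noF; exists F.
  by case: ifP => ?; case: ifP => ? //; lia.
have := Pg _ AF; rewrite ifF; last by lia.
move=> /(face_leP C) []; rewrite face_at_rk; last by lia.
move=> _ [v [gv Fv]]; rewrite Fm in Fv.
have vg : istab x r (v * g^-1) by apply/(face_at_eq C); exact: esym gv.
have [u [w [uP wP E]]] := istab_factor C vg.
have E' : w * g = u^-1 * v by rewrite -[v](mulgVK g) E -mulgA mulKg.
have Fw : F = face_at x m%:Z (w * g).
  by rewrite E' Fv face_at_mull //; apply: gen_subgroupV; apply: uP; lia.
exists m%:Z, (w * g); split; [lia|lia|] => F' AF'.
rewrite -Fw; case: ifP => F'm; last first.
  have [FF'|F'F] := chA _ _ AF AF' => //.
  by have := face_le_rk F'F; lia.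
have [F'E|F'm'] := eqVneq (face_rk F') m%:Z.
  rewrite F'E; split=> //; rewrite -Fw.
  have [FF'|F'F] := chA _ _ AF AF'; last by apply: face_le_rk_eq => //; lia.
  by apply/esym; apply: face_le_rk_eq => //; lia.
have := Pg _ AF'; rewrite ifT; last by lia.
move=> [F'r F'g]; split; first by lia.
by rewrite face_at_mull //; exact: wP.
Qed.

Lemma chain_on g (A : set (face x)) :
  (forall F, A F -> F = face_at x (face_rk F) g) -> chain (@face_le _ _ x) A.
Proof.
move=> Ag F F' /Ag Fg /Ag F'g.
have [FF'|/ltW F'F] := leP (face_rk F) (face_rk F').
  by left; exact: face_le_on Fg F'g FF'.
by right; exact: face_le_on F'g Fg F'F.
Qed.

(** Splitting [h * g^-1] at the middle rank turns [g] and [h] into one element that represents both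
    outer faces. *)
Lemma face_le_trans (F1 F2 F3 : face x) :
  face_le F1 F2 -> face_le F2 F3 -> face_le F1 F3.
Proof.
move=> /[dup] le12 /(face_leP C) [r12 [g [F1g F2g]]].
move=> /[dup] le23 /(face_leP C) [r23 [h [F2h F3h]]].
have hg : istab x (face_rk F2) (h * g^-1).
  by apply/(face_at_eq C); rewrite -F2g -F2h.
have [u [v [uP vP E]]] := istab_factor C hg.
have E' : v * g = u^-1 * h by rewrite -[h](mulgVK g) E -mulgA mulKg.
apply: (@face_le_on _ _ (v * g)); last by lia.
  by rewrite face_at_mull //; exact: vP.
by rewrite E' face_at_mull //; apply: gen_subgroupV; exact: uP.
Qed.

Lemma face_le_common3 (F1 F2 F3 : face x) :
    face_le F1 F2 -> face_le F2 F3 ->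
  exists g, [/\ F1 = face_at x (face_rk F1) g, F2 = face_at x (face_rk F2) g
    & F3 = face_at x (face_rk F3) g].
Proof.
move=> le12 le23; have le13 := face_le_trans le12 le23.
have refl := face_le_refl.
have [|g Pg] := @chain_common_element [set F | [\/ F = F1, F = F2 | F = F3]].
  by move=> F F' [->|->|->] [->|->|->]; by [left|right].
by exists g; split; apply: Pg; [apply: Or31|apply: Or32|apply: Or33].
Qed.

(** The intersection condition makes two representatives of the pair [F], [H] differ by a word in
    generators fixing both faces; such words become paths in the section. *)
Lemma common_faces_ratio (F H : face x) g h :
    F = face_at x (face_rk F) g -> H = face_at x (face_rk H) g ->
    F = face_at x (face_rk F) h -> H = face_at x (face_rk H) h ->
    (face_rk F < face_rk H)%R ->
  gen_subgroup (x @` [set k : 'I_n | (k : nat)%:Z <> face_rk F /\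
    (k : nat)%:Z <> face_rk H]) (h * g^-1).
Proof.
move=> Fg Hg Fh Hh FH.
have := face_rk_bounds F; have := face_rk_bounds H => Hb Fb.
apply: (istab_inter C); [lia|lia|lia|split; apply/(face_at_eq C)].
  by rewrite -Fg -Fh.
by rewrite -Hg -Hh.
Qed.

(** The diamond condition in terms of representatives: [y] is a word in the generators of index
    other than [i - 1] and [i + 1]. Those other than [x i] commute with [x i] and are absorbed by
    the face of rank [i], so only the parity of the number of letters [x i] matters. *)
Lemma face_at_adjacent (i : 'I_n) y g :
    istab x ((i : nat)%:Z - 1)%R y -> istab x ((i : nat)%:Z + 1)%R y ->
  face_at x (i : nat)%:Z (y * g) = face_at x (i : nat)%:Z g \/
  face_at x (i : nat)%:Z (y * g) = face_at x (i : nat)%:Z (x i * g).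
Proof.
move=> yl yr.
pose D := [set k : 'I_n | (k.+1 < i)%N \/ (i.+1 < k)%N].
have : gen_subgroup (x @` (D `|` [set i])) y.
  have i_n := ltn_ord i.
  have: gen_subgroup (x @` [set k : 'I_n |
      (k : nat)%:Z <> ((i : nat)%:Z - 1)%R /\
      (k : nat)%:Z <> ((i : nat)%:Z + 1)%R]) y.
    by apply: (istab_inter C); [lia|lia|lia|split].
  apply: gen_subgroup_mono => _ [k [kl kr] <-]; exists k => //.
  have [->|ki] := eqVneq k i; first by right.
  have {}ki : (k : nat) <> i by move/ord_inj; apply/eqP.
  by left; rewrite /D /=; lia.
have DE (j k : 'I_n) : D j -> [set i] k -> x j * x k = x k * x j.
  by move=> [jk|kj] ->; [|symmetry]; exact: sc_comm.
move=> /(commuting_gen_factor (sc_invol C) DE) [w [z [Dw Ez ->]]].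
have iw : istab x (i : nat)%:Z w.
  apply: gen_subgroup_mono Dw => _ [k Dk <-]; exists k => //;
  by move: Dk; rewrite /D /=; lia.
rewrite -mulgA (face_at_mull C _ (u := w)) //.
suff [->|->] : z = 1 \/ z = x i; [by left; rewrite mul1g|by right|].
move: z Ez; apply: (invol_gen_ind (sc_invol C)); first by left.
move=> _ z -> _ [->|->]; first by right; rewrite mulg1.
by left; rewrite sc_invol.
Qed.

Lemma face_at_neq (i : 'I_n) g :
  face_at x (i : nat)%:Z (x i * g) <> face_at x (i : nat)%:Z g.
Proof. by move=> /(face_at_eq C); rewrite mulgK -stab_istab; exact: sc_notin. Qed.

End Chains.

(** * Polytope axioms for an interval, covering the whole poset and its sections at once *)

Section IntervalPolytope.
Local Open Scope ring_scope.
Local Open Scope group_scope.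
Variables (G : groupType) (n : nat) (x : 'I_n -> G).
Hypothesis C : string_C_group x.
Variables (T : Type) (iota : T -> face x) (F0 G0 : face x) (m : nat).
Hypothesis iota_inj : injective iota.
Hypothesis iota_im : forall F,
  (exists t, iota t = F) <-> face_le F0 F /\ face_le F G0.
Hypothesis le_FG0 : face_le F0 G0.
Hypothesis rk_FG0 : (face_rk G0 - face_rk F0 - 1)%R = m%:Z.

Let le t u := face_le (iota t) (iota u).
Let rk t := (face_rk (iota t) - face_rk F0 - 1)%R.

Lemma iota_le t : face_le F0 (iota t) /\ face_le (iota t) G0.
Proof. by apply/iota_im; exists t. Qed.

Lemma iota_between t u F :
  face_le (iota t) F -> face_le F (iota u) -> exists v, iota v = F.
Proof.
move=> tF Fu; apply/iota_im; split.
  exact: face_le_trans C _ _ _ (iota_le t).1 tF.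
exact: face_le_trans C _ _ _ Fu (iota_le u).2.
Qed.

Lemma interval_chain_common (A : set T) : chain le A ->
  exists g, [/\ F0 = face_at x (face_rk F0) g, G0 = face_at x (face_rk G0) g &
    forall t, A t -> iota t = face_at x (face_rk (iota t)) g].
Proof.
move=> chA.
have [|g Pg] := @chain_common_element _ _ _ C
  [set F | [\/ F = F0, F = G0 | exists2 t, A t & iota t = F]].
  have refl := face_le_refl C.
  move=> F F' [->|->|[t At <-]] [->|->|[u Au <-]]; try by [left|right].
  - by left; exact: (iota_le u).1.
  - by right; exact: (iota_le u).2.
  - by right; exact: (iota_le t).1.
  - by left; exact: (iota_le t).2.
  - exact: chA.
exists g; split=> [||t At]; apply: Pg.
- exact: Or31.
- exact: Or32.
- by apply: Or33; exists t.
Qed.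

Lemma interval_flag (A : set T) : flag le A ->
  exists g, [/\ F0 = face_at x (face_rk F0) g, G0 = face_at x (face_rk G0) g &
    A = [set t | iota t = face_at x (face_rk (iota t)) g]].
Proof.
move=> [chA maxA]; have [g [F0g G0g Ag]] := interval_chain_common chA.
exists g; split=> //; apply/esym/maxA => // t u /= tg ug.
have [tu|/ltW ut] := leP (face_rk (iota t)) (face_rk (iota u)).
  by left; exact: face_le_on C _ _ _ tg ug tu.
by right; exact: face_le_on C _ _ _ ug tg ut.
Qed.

Lemma interval_face_at g r :
    F0 = face_at x (face_rk F0) g -> G0 = face_at x (face_rk G0) g ->
    (face_rk F0 <= r <= face_rk G0)%R ->
  exists t, iota t = face_at x r g.
Proof.
move=> F0g G0g r0; apply/iota_im; rewrite F0g G0g.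
have := face_rk_bounds F0; have := face_rk_bounds G0.
by split; apply: (face_le_at C); lia.
Qed.

Lemma interval_flag_card (A : set T) : flag le A -> A #= `I_(m + 2).
Proof.
move=> /interval_flag [g [F0g G0g ->]].
have /choice [f fP] : forall k, exists t, (k < m + 2)%N ->
    iota t = face_at x (face_rk F0 + k%:Z)%R g.
  move=> k; have [km|] := boolP (k < m + 2)%N.
    have [|t tE] := @interval_face_at g (face_rk F0 + k%:Z)%R F0g G0g.
      by lia.
    by exists t.
  (* Only the [m + 2] ranks from that of [F0] to that of [G0] matter; beyond them [f] takes a dummy
     value. *)
  have [|t tE] := @interval_face_at g (face_rk F0) F0g G0g; first by lia.
  by exists t.
have fr k : (k < m + 2)%N -> face_rk (iota (f k)) = (face_rk F0 + k%:Z)%R.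
  move=> km; rewrite fP // face_at_rk //.
  by have := face_rk_bounds F0; have := face_rk_bounds G0; lia.
apply: (@card_eq_enum _ _ _ f) => [k km|t /= tg|k l km lm].
- by rewrite /= fr // fP.
- have := face_le_rk C (iota_le t).1; have := face_le_rk C (iota_le t).2.
  move=> tG Ft; exists (absz (face_rk (iota t) - face_rk F0)%R); first by lia.
  apply: iota_inj; rewrite fP; last by lia.
  by rewrite {1}tg; congr face_at; lia.
- by move=> /(congr1 (fun t => face_rk (iota t))); rewrite !fr //; lia.
Qed.

Lemma interval_between (F H : T) : le F H -> forall t,
  between le F H t <->
    (face_rk (iota F) < face_rk (iota t) < face_rk (iota H))%R /\
    exists g, [/\ iota F = face_at x (face_rk (iota F)) g,
      iota t = face_at x (face_rk (iota t)) g &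
      iota H = face_at x (face_rk (iota H)) g].
Proof.
move=> FH t; split=> [[[Ft nFt] [tH ntH]]|[rt [g [Fg tg Hg]]]].
  split; last exact: face_le_common3 C _ _ _ Ft tH.
  have rFt : face_rk (iota F) <> face_rk (iota t).
    by move=> /(face_le_rk_eq C Ft)/iota_inj.
  have rtH : face_rk (iota t) <> face_rk (iota H).
    by move=> /(face_le_rk_eq C tH)/iota_inj.
  by have := face_le_rk C Ft; have := face_le_rk C tH; lia.
split; split.
- by apply: (face_le_on C Fg tg); lia.
- by move=> E; move: rt; rewrite E; lia.
- by apply: (face_le_on C tg Hg); lia.
- by move=> E; move: rt; rewrite E; lia.
Qed.

Lemma interval_between_at (F H : T) g r :
    iota F = face_at x (face_rk (iota F)) g ->
    iota H = face_at x (face_rk (iota H)) g ->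
    (face_rk (iota F) < r < face_rk (iota H))%R ->
  exists t, [/\ between le F H t, iota t = face_at x r g
    & face_rk (iota t) = r].
Proof.
move=> Fg Hg rr.
have := face_rk_bounds (iota F); have := face_rk_bounds (iota H) => Hb Fb.
have FH : le F H by apply: (face_le_on C Fg Hg); lia.
have [||t tr] := @iota_between F H (face_at x r g).
- by rewrite Fg; apply: (face_le_at C); lia.
- by rewrite Hg; apply: (face_le_at C); lia.
have rtr : face_rk (iota t) = r by rewrite tr face_at_rk //; lia.
exists t; split=> //; apply/(interval_between FH).
by rewrite rtr; split=> //; exists g.
Qed.

(** [K] and [L] lie on representatives differing by a word [w] in generators that fix [F] and [H]. A
    letter [x i] changes only the face of rank [i], so the path is built letter by letter. *)
Lemma interval_connected (F H : T) :
  le F H -> (2 <= rk H - rk F - 1)%R -> section_connected le F H.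
Proof.
move=> FH; rewrite /rk => rFH K L FHK FHL.
have [rK [g [Fg Kg Hg]]] := (interval_between FH K).1 FHK.
have [rL [h [Fh Lh Hh]]] := (interval_between FH L).1 FHL.
have := common_faces_ratio C Fg Hg Fh Hh; move=> /(_ ltac:(lia)).
have hE : h = h * g^-1 * g by rewrite mulgVK.
move: (h * g^-1) hE => w hE Dw; subst h; clear Fh Hh.
have inc A B k : between le F H A -> between le F H B ->
    iota A = face_at x (face_rk (iota A)) k ->
    iota B = face_at x (face_rk (iota B)) k ->
    Relation_Operators.clos_refl_trans T (incident_in le (between le F H)) A B.
  move=> FHA FHB Ak Bk; apply: Relation_Operators.rt_step; split=> //.
  have [AB|/ltW BA] := leP (face_rk (iota A)) (face_rk (iota B)).
    by left; exact: (face_le_on C Ak Bk).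
  by right; exact: (face_le_on C Bk Ak).
move: w Dw L FHL rL Lh; apply: (invol_gen_ind (sc_invol C)).
  by move=> L FHL rL; rewrite mul1g => Lg; exact: inc Kg Lg.
move=> i w [/= iF iH] Dw IH L FHL rL Lg.
have wF : istab x (face_rk (iota F)) w.
  by apply: gen_subgroup_mono Dw => _ [j [jF _] <-]; exists j.
have wH : istab x (face_rk (iota H)) w.
  by apply: gen_subgroup_mono Dw => _ [j [_ jH] <-]; exists j.
have [iL|iL] := eqVneq (i : nat)%:Z (face_rk (iota L)); last first.
  apply: (IH L) => //; rewrite {1}Lg -mulgA (face_at_mull C (w * g) (u := x i)) //.
  by apply: istab_gen; apply/eqP.
(* The letter [x i] moves the face of the rank of [L]. A section of rank at least 2 has a second
   rank [r] available, and its face [M] is the same on [w * g] and on [x i * w * g]: it links the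
   old flag to [L]. *)
have [r [rF rH rL']] : exists r, [/\ (face_rk (iota F) < r)%R,
    (r < face_rk (iota H))%R & r <> face_rk (iota L)].
  have [E|E] := eqVneq (face_rk (iota L)) (face_rk (iota F) + 1)%R.
    by exists (face_rk (iota F) + 2)%R; split; lia.
  by exists (face_rk (iota F) + 1)%R; split; lia.
have [|||M [FHM Mg rM]] := @interval_between_at F H (w * g) r.
- by rewrite face_at_mull.
- by rewrite face_at_mull.
- by lia.
apply: (@Relation_Operators.rt_trans _ _ _ M).
  by apply: IH => //; rewrite rM ?rF.
apply: (inc _ _ (x i * w * g)) => //.
rewrite rM Mg -mulgA (face_at_mull C (w * g) (u := x i)) //; apply: istab_gen.
by rewrite iL; exact: nesym.
Qed.

Lemma interval_diamond (F H : T) :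
  le F H -> (rk H - rk F)%R = 2 -> between le F H #= `I_2.
Proof.
move=> FH; rewrite /rk => rFH.
have := face_rk_bounds (iota F); have := face_rk_bounds (iota H) => Hb Fb.
have /(face_leP C) [_ [g [Fg Hg]]] := FH.
have [i iF] : exists i : 'I_n, (i : nat)%:Z = (face_rk (iota F) + 1)%R.
  have lt_n : (absz (face_rk (iota F) + 1)%R < n)%N by lia.
  by exists (Ordinal lt_n) => /=; lia.
have xF : istab x (face_rk (iota F)) (x i) by apply: istab_gen; lia.
have xH : istab x (face_rk (iota H)) (x i) by apply: istab_gen; lia.
have [|t [FHt tg rt]] := interval_between_at (r := (i : nat)%:Z) Fg Hg; first by lia.
have [|||u [FHu ug ru]] := @interval_between_at F H (x i * g) (i : nat)%:Z.
- by rewrite face_at_mull.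
- by rewrite face_at_mull.
- by lia.
apply: (@card_eq_enum _ _ _ (fun k => if k is 0%N then t else u)).
- by case.
- move=> v /(interval_between FH) [rv [h [Fh vh Hh]]].
  have {}rv : face_rk (iota v) = (i : nat)%:Z by lia.
  have hE : h = h * g^-1 * g by rewrite mulgVK.
  have hF : istab x ((i : nat)%:Z - 1)%R (h * g^-1).
    apply/(face_at_eq C); rewrite (_ : _ - 1 = face_rk (iota F))%R; last by lia.
    by rewrite -Fg -Fh.
  have hH : istab x ((i : nat)%:Z + 1)%R (h * g^-1).
    apply/(face_at_eq C); rewrite (_ : _ + 1 = face_rk (iota H))%R; last by lia.
    by rewrite -Hg -Hh.
  have [vz|vz] := face_at_adjacent C g hF hH; rewrite -hE -[in LHS]rv -vh in vz.
  + by exists 0%N => //; apply: iota_inj; rewrite vz tg.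
  + by exists 1%N => //; apply: iota_inj; rewrite vz ug.
- have tu : t <> u.
    by move=> /(congr1 iota); rewrite tg ug => /esym; exact: (face_at_neq C).
  by move=> [|[|k]] [|[|l]] // _ _ // /esym.
Qed.

Theorem interval_is_polytope : is_polytope le rk m.
Proof.
have le_F0 t : (face_rk F0 <= face_rk (iota t))%R.
  exact: face_le_rk C _ _ (iota_le t).1.
have le_G0 t : (face_rk (iota t) <= face_rk G0)%R.
  exact: face_le_rk C _ _ (iota_le t).2.
have refl := face_le_refl C.
split.
- by move=> F; exact: refl.
- move=> F H FH HF; apply: iota_inj; apply: (face_le_rk_eq C) => //.
  by have := face_le_rk C FH; have := face_le_rk C HF; lia.
- by move=> F H K; exact: face_le_trans.
- by move=> F; rewrite /rk; have := le_F0 F; have := le_G0 F; lia.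
- move=> F H [FH nFH]; rewrite /rk.
  suff : face_rk (iota F) <> face_rk (iota H) by have := face_le_rk C FH; lia.
  by move=> /(face_le_rk_eq C FH)/iota_inj.
- have [t tF] : exists t, iota t = F0 by apply/iota_im.
  by exists t => u; rewrite /le tF; exact: (iota_le u).1.
- have [t tF] : exists t, iota t = G0 by apply/iota_im.
  by exists t => u; rewrite /le tF; exact: (iota_le u).2.
- exact: interval_flag_card.
- exact: interval_connected.
- exact: interval_diamond.
Qed.

End IntervalPolytope.

(** * The coset poset: polygonal sections and flags *)

Section CosetPolytope.
Local Open Scope ring_scope.
Local Open Scope group_scope.
Variables (G : groupType) (n : nat) (x : 'I_n -> G).
Hypothesis C : string_C_group x.
Local Notation le := (@face_le G n x).
Local Notation rk := (@face_rk G n x).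

Lemma coset_poset_is_polytope : is_polytope le rk n.
Proof.
have := @interval_is_polytope _ _ _ C (face x) id (Least x) (Greatest x) n.
have -> : (fun t : face x => face_rk (id t) - face_rk (Least x) - 1)%R = rk.
  by apply/funext => F /=; lia.
apply=> //; last by rewrite /=; lia.
by move=> F; split=> [_|_]; [split=> //; case: F|exists F].
Qed.

Lemma sval_section_inj (F H : face x) :
  injective (@sval _ _ : section le F H -> face x).
Proof.
by move=> [t tP] [u uP] /= tu; subst u; congr exist; exact: Prop_irrelevance.
Qed.

Lemma section_is_polytope (F H : face x) m : le F H ->
    (rk H - rk F - 1)%R = m%:Z ->
  is_polytope (@section_le _ le F H) (@section_rk _ le rk F H) m.
Proof.
move=> FH rFH; apply: (interval_is_polytope C _ _ FH rFH).
  exact: sval_section_inj.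
by move=> K; split=> [[[t tP] <-] //|KP]; last by exists (exist _ K KP).
Qed.

(** The vertices of the section are the faces of rank [i] on [(x j * x i) ^+ k * g] for [k < p].
    Indeed two representatives of [F] and [H] differ by [u * v], with [v] in the dihedral group of
    [x i] and [x j], and [u] a word in generators commuting with both, which the vertex absorbs. The
    hypothesis on [stab x i] separates these vertices. *)
Lemma section_is_polygon (F H : face x) (i j : 'I_n) p :
    (j : nat) = i.+1 -> (0 < p)%N -> (x i * x j) ^+ p = 1 ->
    (forall k, stab x i ((x i * x j) ^+ k) -> (p %| k)%N) ->
    le F H -> rk F = ((i : nat)%:Z - 1)%R -> rk H = ((i : nat)%:Z + 2)%R ->
  is_polygon p (@section_le _ le F H) (@section_rk _ le rk F H).
Proof.
move=> ji p0 ijp ijk FH rF rH; split.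
  by apply: section_is_polytope => //; lia.
have xx := sc_invol C.
have /(face_leP C) [_ [g [Fg Hg]]] := FH.
have Hb := face_rk_bounds H.
have stabF k : istab x (rk F) ((x j * x i) ^+ k).
  by apply: gen_subgroupX; apply: gen_subgroupM; apply: istab_gen; lia.
have stabH k : istab x (rk H) ((x j * x i) ^+ k).
  by apply: gen_subgroupX; apply: gen_subgroupM; apply: istab_gen; lia.
have /choice [f fP] : forall k, exists t : section le F H,
    sval t = face_at x (i : nat)%:Z ((x j * x i) ^+ k * g).
  move=> k; set K := face_at _ _ _.
  have FK : le F K.
    by rewrite Fg -(face_at_mull C g (stabF k)); apply: (face_le_at C); lia.
  have KH : le K H.
    by rewrite Hg -(face_at_mull C g (stabH k)); apply: (face_le_at C); lia.
  by exists (exist _ K (conj FK KH)).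
have rf k : rk (sval (f k)) = (i : nat)%:Z by rewrite fP face_at_rk //; lia.
apply: (@card_eq_enum _ _ _ f) => [k _|t|k l kp lp /(congr1 (@sval _ _))].
- by rewrite /= /section_rk rf; lia.
- rewrite /= /section_rk => rt.
  have {}rt : rk (sval t) = (i : nat)%:Z by lia.
  have [Ft tH] := svalP t.
  have [h [Fh th Hh]] := face_le_common3 C Ft tH.
  have := common_faces_ratio C Fg Hg Fh Hh.
  move=> /(_ ltac:(lia)).
  pose D := [set k : 'I_n | (k.+1 < i)%N \/ (j.+1 < k)%N].
  have -> : [set k : 'I_n | (k : nat)%:Z <> rk F /\
      (k : nat)%:Z <> rk H] = D `|` [set i; j].
    apply/seteqP; split=> k /=; rewrite rF rH.
      move=> [kF kH]; have [->|ki] := eqVneq k i; first by right; left.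
      have [->|kj] := eqVneq k j; first by right; right.
      have {}ki : (k : nat) <> i by move/ord_inj; apply/eqP.
      have {}kj : (k : nat) <> j by move/ord_inj; apply/eqP.
      by left; rewrite /D /=; lia.
    by move=> [|[->|->]]; rewrite /D /=; lia.
  have DE (k l : 'I_n) : D k -> [set i; j] l -> x k * x l = x l * x k.
    by move=> [kl|lk] [->|->]; [| |symmetry|symmetry]; apply: (sc_comm C); lia.
  move=> /(commuting_gen_factor xx DE) [u [v [Du Ev E]]].
  (* Taking the normal form of [v^-1] puts the reflection on the left of [v], where a face of rank
     [i] absorbs it. *)
  have [k [e vE]] := dihedral_form xx p0 ijp (gen_subgroupV Ev).
  have {}vE : v = x j ^+ e * (x j * x i) ^+ k.
    rewrite -[v]invgK vE invgM invol_mul_expgV ?xx //; congr (_ * _).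
    by case: (e); rewrite /= ?expg1 ?expg0 ?invg1 ?(invol_inv xx).
  have jip : (x j * x i) ^+ p = 1 by rewrite -invol_mul_expgV ?xx // ijp invg1.
  exists (k %% p)%N; first by rewrite ltn_mod.
  apply: sval_section_inj; rewrite fP expg_modn // th rt.
  rewrite -[h](mulgVK g) E vE -!mulgA.
  rewrite (face_at_mull C _ (u := u)); last first.
    apply: gen_subgroup_mono Du => _ [k' Dk <-]; exists k' => //.
    by move: Dk; rewrite /D /=; lia.
  rewrite (face_at_mull C _ (u := x j ^+ e)) //.
  by apply: gen_subgroupX; apply: istab_gen; lia.
- rewrite !fP => /(face_at_eq C).
  wlog lk : k l kp lp / (l <= k)%N.
    move=> W; have [lk|/ltnW kl] := leqP l k; first exact: W.
    by move=> E; apply/esym; apply: W => //; apply/(face_at_eq C); symmetry;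
      apply/(face_at_eq C).
  rewrite invgM mulgA mulgK -stab_istab -{1}(subnK lk) expgnDr mulgK.
  move=> /gen_subgroupV; rewrite invol_mul_expgV ?xx // => /ijk.
  move=> /dvdnP [q qE]; case: q qE => [|q]; first by lia.
  by rewrite mulSn; lia.
Qed.

Definition flag_at (g : G) : set (face x) := [set F | F = face_at x (rk F) g].

Lemma flag_at_face g r : (-1 <= r <= n%:Z)%R -> flag_at g (face_at x r g).
Proof. by move=> rn; rewrite /flag_at /= face_at_rk. Qed.

Lemma flag_at_chain g : chain le (flag_at g).
Proof. by apply: (chain_on C (g := g)) => F Fg; exact: Fg. Qed.

Lemma flag_atP A : flag le A <-> exists g, A = flag_at g.
Proof.
split=> [[chA maxA]|[g ->]].
  have [g Ag] := chain_common_element C chA.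
  by exists g; apply/esym/maxA => //; exact: flag_at_chain.
split; first exact: flag_at_chain.
move=> D chD gD; have [h Dh] := chain_common_element C chD.
apply/seteqP; split=> // F DF; rewrite /flag_at /= {1}(Dh _ DF).
have Fn := face_rk_bounds F.
have := Dh _ (gD _ (flag_at_face g Fn)).
by rewrite face_at_rk.
Qed.

Lemma flag_at_inj : injective flag_at.
Proof.
move=> g h gh; suff : g * h^-1 = 1 by move/mulg1_eq/invg_inj.
apply: (sc_core C) => i; rewrite stab_istab; apply/(face_at_eq C).
have in_ : (-1 <= (i : nat)%:Z <= n%:Z)%R by have := ltn_ord i; lia.
by have := flag_at_face g in_; rewrite gh /flag_at /= face_at_rk.
Qed.

Lemma flag_card N : [set: G] #= `I_N -> [set A | flag le A] #= `I_N.
Proof.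
apply: card_eq_trans.
have -> : [set A | flag le A] = flag_at @` [set: G].
  apply/seteqP; split=> [A /flag_atP [g ->]|_ [g _ <-]]; first by exists g.
  by apply/flag_atP; exists g.
by apply: inj_card_eq => g h _ _; exact: flag_at_inj.
Qed.

End CosetPolytope.
Arguments flag_at {G n} x g.

(** * Automorphisms of the coset poset *)

Section Automorphisms.
Local Open Scope ring_scope.
Local Open Scope group_scope.
Variables (G : groupType) (n : nat) (x : 'I_n -> G).
Hypothesis C : string_C_group x.
Local Notation le := (@face_le G n x).
Local Notation rk := (@face_rk G n x).
Implicit Types (g h u v : G) (F H : face x) (a b : aut le).

Lemma translate_coset (A : coset_face x) h :
  exists g, [set u * h | u in cf_set A] = right_coset (stab x (cf_rank A)) g.
Proof.
have [g ->] := cf_setP A; exists (g * h); apply/seteqP.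
split=> [_ [_ [u su <-] <-]|].
  by exists u; rewrite ?mulgA.
by move=> _ [u su <-]; exists (u * g); [exists u|rewrite mulgA].
Qed.

Definition translate_face h F : face x :=
  match F with
  | Least => Least x
  | Proper A => Proper (CosetFace (translate_coset A h))
  | Greatest => Greatest x
  end.

Lemma translate_face_rk h F : rk (translate_face h F) = rk F.
Proof. by case: F. Qed.

Lemma translate_face_at h r g :
  translate_face h (face_at x r g) = face_at x r (g * h).
Proof.
have [[_ E]|[i _ E]|[_ E]] := face_at_cases x r; rewrite !E //=.
congr Proper; apply: coset_face_ext => /=.
apply/seteqP; split=> [_ [_ [u su <-] <-]|].
  by exists u; rewrite ?mulgA.
by move=> _ [u su <-]; exists (u * g); [exists u|rewrite mulgA].
Qed.

Lemma translate_faceM g h F :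
  translate_face h (translate_face g F) = translate_face (g * h) F.
Proof. by have [u ->] := faceP F; rewrite !translate_face_at mulgA. Qed.

Lemma translate_face1 F : translate_face 1 F = F.
Proof. by have [u Fu] := faceP F; rewrite Fu translate_face_at mulg1. Qed.

Lemma translate_faceK h : cancel (translate_face h) (translate_face h^-1).
Proof. by move=> F; rewrite translate_faceM mulgV translate_face1. Qed.

Lemma translate_faceVK h : cancel (translate_face h^-1) (translate_face h).
Proof. by move=> F; rewrite translate_faceM mulVg translate_face1. Qed.

Lemma translate_face_mono h F H :
  le F H -> le (translate_face h F) (translate_face h H).
Proof.
move=> /(face_leP C) [FH [g [Fg Hg]]]; apply/(face_leP C).
rewrite !translate_face_rk; split=> //; exists (g * h).
by rewrite {1}Fg {1}Hg !translate_face_at.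
Qed.

Lemma translate_face_le h F H :
  le (translate_face h F) (translate_face h H) <-> le F H.
Proof.
split=> [/(@translate_face_mono h^-1)|]; last exact: translate_face_mono.
by rewrite !translate_faceK.
Qed.

Definition translation h : aut le :=
  @Aut _ le (translate_face h) (translate_face h^-1)
    (@translate_faceK h) (@translate_faceVK h) (@translate_face_le h).

Lemma translationM g h : translation (g * h) = translation g * translation h.
Proof. by apply: autP => F /=; rewrite translate_faceM. Qed.

Lemma translation1 : translation 1 = 1.
Proof. by apply: autP => F /=; rewrite translate_face1. Qed.

Lemma translation_flag h g : translation h @` flag_at x g = flag_at x (g * h).
Proof.
apply/seteqP; split=> [_ [F Fg <-]|F Fgh].
  by rewrite /flag_at /= translate_face_rk {1}Fg translate_face_at.
exists (face_at x (rk F) g).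
  by apply: flag_at_face; exact: face_rk_bounds.
by rewrite /= translate_face_at -Fgh.
Qed.

Lemma translation_inj : injective translation.
Proof.
move=> g h gh; have := translation_flag g 1; rewrite gh translation_flag !mul1g.
by move/(flag_at_inj C).
Qed.

Lemma coset_poset_is_regular : is_regular le.
Proof.
move=> A B /(flag_atP C) [g ->] /(flag_atP C) [h ->].
by exists (translation (g^-1 * h)); rewrite translation_flag mulgA mulgV mul1g.
Qed.

Lemma aut_inj a : injective a.
Proof. exact: can_inj (aut_funK a). Qed.

Lemma aut_flag a A : flag le A -> flag le (a @` A).
Proof.
move=> [chA maxA]; split=> [_ _ [F AF <-] [H AH <-]|D chD aAD].
  by have [FH|HF] := chA _ _ AF AH; [left|right]; apply/aut_le.
have <- : a @^-1` D = A.
  apply: maxA => [F H /= DF DH|F AF]; last by apply: aAD; exists F.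
  by have [FH|HF] := chD _ _ DF DH; [left|right]; apply/(aut_le a).
apply/seteqP; split=> [F DF|_ [F DF <-] //].
by exists (aut_inv a F); rewrite /= ?aut_invK.
Qed.

(** An automorphism is only known to preserve order, so ranks have to be recovered: along a flag the
    ranks of the images increase strictly over [n + 2] steps within the bounds -1 and [n], hence are
    unchanged. *)
Lemma aut_flag_at a g : exists h, forall r, (-1 <= r <= n%:Z)%R ->
  a (face_at x r g) = face_at x r h.
Proof.
have : flag le (flag_at x g) by apply/(flag_atP C); exists g.
move=> /(@aut_flag a) /(flag_atP C) [h gh]; exists h.
have ah r : (-1 <= r <= n%:Z)%R ->
    a (face_at x r g) = face_at x (rk (a (face_at x r g))) h.
  move=> rn; have: flag_at x h (a (face_at x r g)); last by [].
  by rewrite -gh; exists (face_at x r g) => //; exact: flag_at_face.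
pose f r := rk (a (face_at x r g)).
have f_lt r s : (-1 <= r)%R -> (r < s)%R -> (s <= n%:Z)%R -> (f r < f s)%R.
  move=> r1 rs sn.
  have rs_le : le (face_at x r g) (face_at x s g) by apply: (face_le_at C); lia.
  move/(aut_le a) in rs_le; have := face_le_rk C rs_le.
  rewrite -/(f r) -/(f s) => frs; suff : f r <> f s by lia.
  move=> /(face_le_rk_eq C rs_le) /aut_inj /(congr1 (@face_rk _ _ x)).
  by rewrite !face_at_rk; lia.
have f_ge k : (k <= n.+1)%N -> (k%:Z - 1 <= f (k%:Z - 1))%R.
  elim: k => [_|k IH kn].
    by have := face_rk_bounds (a (face_at x (0%:Z - 1)%R g)); rewrite /f; lia.
  have := IH (ltnW kn); have := @f_lt (k%:Z - 1)%R (k.+1%:Z - 1)%R.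
  by move=> /(_ ltac:(lia) ltac:(lia) ltac:(lia)); lia.
have f_le k : (k <= n.+1)%N -> (f (n%:Z - k%:Z) <= n%:Z - k%:Z)%R.
  elim: k => [_|k IH kn].
    have := face_rk_bounds (a (face_at x (n%:Z - 0%:Z)%R g)).
    by rewrite /f; lia.
  have := IH (ltnW kn); have := @f_lt (n%:Z - k.+1%:Z)%R (n%:Z - k%:Z)%R.
  by move=> /(_ ltac:(lia) ltac:(lia) ltac:(lia)); lia.
move=> r rn; rewrite ah //; congr face_at; rewrite -/(f r).
have := f_ge (absz (r + 1)%R); have := f_le (absz (n%:Z - r)%R).
rewrite (_ : (absz (r + 1)%R)%:Z - 1 = r)%R; last by lia.
rewrite (_ : n%:Z - (absz (n%:Z - r)%R)%:Z = r)%R; last by lia.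
by move=> /(_ ltac:(lia)) ? /(_ ltac:(lia)) ?; lia.
Qed.

(* Flags are connected through adjacent flags, and an automorphism fixing a
   flag fixes the adjacent ones. *)
Lemma aut_fixing_flag a :
    (forall r, (-1 <= r <= n%:Z)%R -> a (face_at x r 1) = face_at x r 1) ->
  a = 1.
Proof.
move=> a1; suff aP u r : (-1 <= r <= n%:Z)%R -> a (face_at x r u) = face_at x r u.
  apply: autP => F; have [v Fv] := faceP F.
  by have := aP v _ (face_rk_bounds F); rewrite -Fv.
move: r; have : gen_subgroup (range x) u by rewrite (sc_gen C).
move: u; apply: (invol_gen_ind (sc_invol C)) => [//|i u _ _ IH r rn].
have [h ah] := aut_flag_at a (x i * u).
have in_ := ltn_ord i.
have hr s : (-1 <= s <= n%:Z)%R -> s <> (i : nat)%:Z -> istab x s (h * u^-1).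
  move=> sn si; apply/(face_at_eq C); rewrite -ah // face_at_mull ?IH //.
  by apply: istab_gen; exact: nesym.
have [->|ri] := eqVneq r (i : nat)%:Z; last first.
  by rewrite face_at_mull ?IH //; apply: istab_gen => E; rewrite E eqxx in ri.
have ai := ah (i : nat)%:Z ltac:(lia).
have := @face_at_adjacent _ _ _ C i (h * u^-1) u.
rewrite mulgVK => /(_ (hr ((i : nat)%:Z - 1)%R ltac:(lia) ltac:(lia))
  (hr ((i : nat)%:Z + 1)%R ltac:(lia) ltac:(lia))).
rewrite ai => -[E|//]; exfalso; apply: (face_at_neq C (i := i) (g := u)).
by apply: (@aut_inj a); rewrite ai E IH //; lia.
Qed.

Lemma aut_is_translation a : exists h, a = translation h.
Proof.
have [h ah] := aut_flag_at a 1; exists h.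
suff E : a * translation h^-1 = 1.
  by rewrite -[a]mulg1 -translation1 -[1](mulVg h) translationM mulgA E mul1g.
apply: aut_fixing_flag => r rn.
rewrite [LHS]/= ah // translate_face_at; apply/(face_at_eq C).
by rewrite mulgV mul1g invg1; exact: gen_subgroup1.
Qed.

End Automorphisms.

(** * The rotation subgroup and its index *)

Section Orientability.
Local Open Scope ring_scope.
Local Open Scope group_scope.
Variables (G : groupType) (n : nat) (x : 'I_n -> G).
Hypothesis C : string_C_group x.
Variables (sg : G -> bool) (i0 : 'I_n).
Hypothesis sg1 : sg 1 = false.
Hypothesis sgM : forall i g, sg (x i * g) = ~~ sg g.
Local Notation le := (@face_le G n x).
Local Notation rk := (@face_rk G n x).

Let xx := sc_invol C.

Lemma all_generated u : gen_subgroup (range x) u.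
Proof. by rewrite (sc_gen C). Qed.

Lemma sign_mul u v : sg (u * v) = sg u (+) sg v.
Proof.
move: u (all_generated u); apply: (invol_gen_ind xx).
  by rewrite mul1g sg1.
by move=> i u _ _ IH; rewrite -mulgA !sgM IH addNb.
Qed.

Lemma sign_inv u : sg u^-1 = sg u.
Proof.
by have := sign_mul u^-1 u; rewrite mulVg sg1; case: (sg _); case: (sg _).
Qed.

Lemma translation_reflection g (j : 'I_n) :
  is_reflection rk (flag_at x g) j (translation C (g^-1 * x j * g)).
Proof.
rewrite /is_reflection /adjacent translation_flag !mulgA mulgV mul1g.
split.
- by apply/(flag_atP C); exists g.
- by apply/(flag_atP C); exists (x j * g).
- move=> /(flag_at_inj C) E; apply: (sc_notin C (i := j)).
  by rewrite -[x j](mulgK g) -E mulgV; exact: gen_subgroup1.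
- move=> F Fj; rewrite /flag_at /= face_at_mull //.
  by apply: istab_gen; exact: nesym.
Qed.

(** At the flag on [g] the reflections are the translations by the conjugates [g^-1 * x j * g], so
    [c] identifies [G] with the automorphism group. Every [r i * r j] telescopes into products of
    consecutive reflections, hence the index is at most 2; the character [sg] vanishes on rotations
    but not on a reflection, hence it is not 1. *)
Lemma coset_poset_orientably_regular : is_orientably_regular le rk n.
Proof.
split=> [|A /(flag_atP C) [g ->]]; first exact: coset_poset_is_regular.
pose c w := translation C (g^-1 * w * g).
have cM u v : c (u * v) = c u * c v.
  by rewrite /c -translationM; congr translation; rewrite !mulgA mulgK.
have c1 : c 1 = 1 by rewrite /c mulg1 mulVg translation1.
have c_inj : injective c.
  move=> u v /(@translation_inj _ _ _ C).
  by rewrite -!mulgA => /mulgI /mulIg.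
have c_surj a : exists w, a = c w.
  have [h ->] := aut_is_translation C a; exists (g * h * g^-1).
  by rewrite /c !mulgA mulVg mul1g mulgVK.
pose r j := c (x j); exists r.
have rr i : r i * r i = 1 by rewrite -cM xx c1.
split=> [j||].
- exact: translation_reflection.
- apply/seteqP; split=> // a _; have [w ->] := c_surj a.
  move: w (all_generated w); apply: (invol_gen_ind xx).
    by rewrite c1; exact: gen_subgroup1.
  move=> i w _ _ IH; rewrite cM; apply: gen_subgroupM => //.
  by apply: gen_subgroup_sub; exists i.
pose R := rotation_subgroup r.
have Rle k : forall i j : 'I_n, (j = i + k :> nat)%N -> R (r i * r j).
  elim: k => [|k IH] i j jk.
    have -> : j = i by apply: ord_inj; rewrite jk addn0.
    by rewrite rr; exact: gen_subgroup1.
  have kn : (i + k < n)%N by have := ltn_ord j; lia.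
  have -> : r i * r j = (r i * r (Ordinal kn)) * (r (Ordinal kn) * r j).
    by rewrite -mulgA (invol_mulK rr).
  apply: gen_subgroupM; first exact: IH.
  by apply: gen_subgroup_sub; exists (Ordinal kn), j; split=> //=; lia.
have Rij i j : R (r i * r j).
  have [ij|/ltnW ji] := leqP i j; first by apply: (Rle (j - i)%N); lia.
  have : R (r j * r i) by apply: (Rle (i - j)%N); lia.
  by move=> /gen_subgroupV; rewrite invgM !(invol_inv rr).
have Rcase w : R (c w) \/ R (r i0 * c w).
  move: w (all_generated w); apply: (invol_gen_ind xx).
    by left; rewrite c1; exact: gen_subgroup1.
  move=> i w _ _ [Rw|Rw]; rewrite cM.
    by right; rewrite mulgA; exact: gen_subgroupM (Rij i0 i) Rw.
  left; rewrite -[c w](invol_mulK rr i0) mulgA.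
  exact: gen_subgroupM (Rij i i0) Rw.
have RnR0 : ~ R (r i0).
  have : R `<=` [set a | exists2 w, a = c w & sg w = false].
    apply: gen_subgroup_min.
      split=> [|_ _ [u -> su] [v -> sv]]; first by exists 1.
      exists (u * v^-1); last by rewrite sign_mul sign_inv su sv.
      rewrite cM; congr (_ * _); apply: mulg1_eq.
      by rewrite -cM mulgV c1.
    move=> _ [i [j [_ ->]]]; exists (x i * x j); first by rewrite cM.
    by rewrite sgM -[x j]mulg1 sgM sg1.
  move=> RS /RS [w /c_inj <-].
  by rewrite -[x i0]mulg1 sgM sg1.
apply: (@card_eq_enum _ _ _ (fun k => right_coset R (r i0 ^+ k))).
- by move=> k _; exists (r i0 ^+ k).
- move=> _ [a _ <-]; have [w aw] := c_surj a^-1.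
  have [Rw|Rw] := Rcase w; rewrite -aw in Rw.
    exists 0%N => //; apply/right_coset_eq; rewrite expg0 invg1 mulg1.
    by rewrite -[a]invgK; exact: gen_subgroupV.
  exists 1%N => //; apply/right_coset_eq; rewrite expg1 -[a]invgK -invgM.
  exact: gen_subgroupV.
- move=> [|[|k]] [|[|l]] // _ _ /right_coset_eq;
    rewrite expg0 expg1 ?invg1 ?mulg1 ?mul1g.
    by rewrite (invol_inv rr).
  by [].
Qed.

End Orientability.

(** * Coordinates for Gamma *)

Lemma ord4_cases (i : 'I_4) :
  [\/ i = inord 0, i = inord 1, i = inord 2 | i = inord 3].
Proof.
have : inord i = i by rewrite inord_val.
case: i => [[|[|[|[|//]]]] lt] /= <-;
  [exact: Or41|exact: Or42|exact: Or43|exact: Or44].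
Qed.

Section CoordinateModel.
Local Open Scope ring_scope.
Variables (p1 p3 q : nat).
Hypotheses (q_dvd1 : (q %| p1)%N) (q_dvd3 : (q %| p3)%N).

(** Coordinates stay integers and a congruence carries its quotient, so compatibility amounts to a
    witness and a polynomial identity. *)
Definition cong (d : nat) (u v : int) : Prop := exists k : int, u = v + k * d%:Z.

Lemma cong_refl d u : cong d u u.
Proof. by exists 0; rewrite mul0r addr0. Qed.

Lemma cong_dvd d d' u v : (d %| d')%N -> cong d' u v -> cong d u v.
Proof. by move=> /dvdnP [m ->] [k ->]; exists (k * m%:Z); rewrite PoszM mulrA. Qed.

(* [State x y z e f] stands for an element of a semidirect product of a
   Heisenberg group by the four-group: with signs [s = (-1)^e], [t = (-1)^f],
   (x, y, z, s, t) (x', y', z', s', t') =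
     (x + s x', y + t y', z + s t z' + t x y' - s y x', s s', t t').
   [x] is taken modulo [p1], [y] modulo [p3], [z] modulo [q], and [step i] is
   left multiplication by the image of the generator [x_i]:
   (1, 0, -1, -, +), (0, 0, 0, -, +), (0, 0, -1, +, -), (0, 1, 0, +, -). *)
Record state := State { sx : int; sy : int; sz : int; se : bool; sf : bool }.

Definition step (i : 'I_4) (m : state) : state :=
  let: State x y z e f := m in
  match (i : nat) with
  | 0%N => State (1 - x) y (y - z - 1) (~~ e) f
  | 1%N => State (- x) y (- z) (~~ e) f
  | 2%N => State x (- y) (- z - 1) e (~~ f)
  | _ => State x (1 - y) (- z - x) e (~~ f)
  end.

Definition base_state := State 0 0 0 false false.

Definition state_eq (m m' : state) : Prop :=
  [/\ cong p1 (sx m) (sx m'), cong p3 (sy m) (sy m'), cong q (sz m) (sz m'),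
      se m = se m' & sf m = sf m'].

Lemma state_eq_refl m : state_eq m m.
Proof. by split=> //; exact: cong_refl. Qed.

Lemma state_eq_sym m m' : state_eq m m' -> state_eq m' m.
Proof.
by move=> [[i hi] [j hj] [k hk] he hf]; split=> //;
  [exists (- i)|exists (- j)|exists (- k)]; rewrite ?hi ?hj ?hk; ring.
Qed.

Lemma state_eq_trans m m' m'' :
  state_eq m m' -> state_eq m' m'' -> state_eq m m''.
Proof.
move=> [[i hi] [j hj] [k hk] he hf] [[i' hi'] [j' hj'] [k' hk'] he' hf'].
split; [exists (i + i')|exists (j + j')|exists (k + k')| |];
  rewrite ?hi ?hj ?hk ?he ?hf ?hi' ?hj' ?hk' //; ring.
Qed.

(** Steps 0 and 3 mix [sy] and [sx] into [sz], so these two coordinates must also make sense modulo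
    [q]. *)
Lemma step_eq i m m' : state_eq m m' -> state_eq (step i m) (step i m').
Proof.
case: m m' => [x y z e f] [x' y' z' e' f'] [/= xx yy zz <- <-].
have /= [a xq] := cong_dvd q_dvd1 xx; have /= [b yq] := cong_dvd q_dvd3 yy.
case: xx yy zz => [k kE] [l lE] [m mE].
have [->|->|->|->] := ord4_cases i; rewrite /step inordK // /state_eq /=; split=> //.
- by exists (- k); rewrite kE; ring.
- by exists l.
- by exists (b - m); rewrite yq mE; ring.
- by exists (- k); rewrite kE; ring.
- by exists l.
- by exists (- m); rewrite mE; ring.
- by exists k.
- by exists (- l); rewrite lE; ring.
- by exists (- m); rewrite mE; ring.
- by exists k.
- by exists (- l); rewrite lE; ring.
- by exists (- m - a); rewrite xq mE; ring.
Qed.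

Lemma stepK i : involutive (step i).
Proof.
case=> x y z e f; have [->|->|->|->] := ord4_cases i;
  rewrite /step inordK //= negbK; congr State; ring.
Qed.

Lemma step_comm (i j : 'I_4) m : (i + 2 <= j)%N || (j + 2 <= i)%N ->
  step i (step j m) = step j (step i m).
Proof.
case: m => x y z e f.
have [->|->|->|->] := ord4_cases i; have [->|->|->|->] := ord4_cases j;
  rewrite /step !inordK //= => _; congr State; ring.
Qed.

Definition act (w : word 'I_4) (m : state) : state :=
  foldr (fun l => step l.1) m w.

Lemma act_cat u v m : act (u ++ v) m = act u (act v m).
Proof. exact: foldr_cat. Qed.

Lemma act_eq w m m' : state_eq m m' -> state_eq (act w m) (act w m').
Proof. by move=> mm; elim: w => //= l w IH; exact: step_eq. Qed.

Lemma act_wpow w n m : act (wpow w n) m = iter n (act w) m.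
Proof. by elim: n => //= n IH; rewrite -IH -act_cat. Qed.

(** [x0 x1] translates [sx], [x3 x2] translates [sy], and each shears [sz] by the coordinate that
    the other one moves; these shears create the commutator. *)
Lemma iter_step01 n m : iter n (act (xw 0 ++ xw 1)) m =
  State (sx m + n%:Z) (sy m) (sz m + n%:Z * (sy m - 1)) (se m) (sf m).
Proof.
elim: n => [|n IH]; first by case: m => x y z e f /=; congr State; ring.
rewrite iterS IH /= /step !inordK //= negbK ?intS; congr State; ring.
Qed.

Lemma iter_step32 n m : iter n (act (xw 3 ++ xw 2)) m =
  State (sx m) (sy m + n%:Z) (sz m + n%:Z * (1 - sx m)) (se m) (sf m).
Proof.
elim: n => [|n IH]; first by case: m => x y z e f /=; congr State; ring.
rewrite iterS IH /= /step !inordK //= negbK ?intS; congr State; ring.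
Qed.

Lemma iter_step23 n m : iter n (act (xw 2 ++ xw 3)) m =
  State (sx m) (sy m - n%:Z) (sz m + n%:Z * (sx m - 1)) (se m) (sf m).
Proof.
elim: n => [|n IH]; first by case: m => x y z e f /=; congr State; ring.
rewrite iterS IH /= /step !inordK //= negbK ?intS; congr State; ring.
Qed.

Lemma iter_step12 n m : iter n.*2 (act (xw 1 ++ xw 2)) m =
  State (sx m) (sy m) (sz m + 2 * n%:Z) (se m) (sf m).
Proof.
elim: n => [|n IH]; first by case: m => x y z e f /=; congr State; ring.
rewrite doubleS !iterS IH /= /step !inordK //= !negbK ?intS.
congr State; ring.
Qed.

Lemma act_relator p2 r : p2 = q.*2 -> Gamma_relator p1 p2 p3 r ->
  forall m, state_eq (act r m) m.
Proof.
move=> p2E; case=> {r} [j|||| j k jk||] m; rewrite act_wpow.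
- by rewrite /= stepK; exact: state_eq_refl.
- rewrite iter_step01; split=> //=; first by exists 1; ring.
  + exact: cong_refl.
  + by have [t ->] := dvdnP q_dvd1; exists (t%:Z * (sy m - 1)); rewrite PoszM; ring.
- rewrite p2E iter_step12; split=> //=; try exact: cong_refl.
  by exists 2; ring.
- rewrite iter_step23; split=> //=; first exact: cong_refl.
  + by exists (-1); ring.
  + by have [t ->] := dvdnP q_dvd3; exists (t%:Z * (sx m - 1)); rewrite PoszM; ring.
- rewrite /= [step k (step j (step k m))]step_comm 1?orbC // !stepK.
  exact: state_eq_refl.
- rewrite /= /step !inordK //; case: m => x y z e f /=; rewrite !negbK.
  by split=> //=; exists 0; ring.
- rewrite /= /step !inordK //; case: m => x y z e f /=; rewrite !negbK.
  by split=> //=; exists 0; ring.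
Qed.

Lemma act_weq p2 u v : p2 = q.*2 -> weq (Gamma_relator p1 p2 p3) u v ->
  forall m, state_eq (act u m) (act v m).
Proof.
move=> p2E; elim=> {u v} [u|u v _ IH|u v w _ IH1 _ IH2|u v i b|u v r Rr] m.
- exact: state_eq_refl.
- exact/state_eq_sym/IH.
- exact: state_eq_trans (IH1 m) (IH2 m).
- by rewrite !act_cat /= stepK; exact: state_eq_refl.
- by rewrite !act_cat; apply: act_eq; exact: act_relator p2E Rr _.
Qed.

(* Coordinates of the subgroup generated by the [x_k] with [k <> j]. *)
Definition stab_state (j : 'I_4) (m : state) : Prop :=
  let: State x y z e f := m in
  match (j : nat) with
  | 0%N => cong p1 x 0
  | 1%N => if e then cong p1 x 1 /\ cong q z (if f then 0 else -1)
           else cong p1 x 0 /\ cong q z (if f then y - 1 else y)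
  | 2%N => if f then cong p3 y 1 /\ cong q z 0
           else cong p3 y 0 /\ cong q z (- x)
  | _ => cong p3 y 0
  end.

Lemma stab_state_base j : stab_state j base_state.
Proof.
by have [->|->|->|->] := ord4_cases j; rewrite /stab_state inordK //=;
  try split; exists 0; ring.
Qed.

Lemma stab_state_eq j m m' : state_eq m m' -> stab_state j m -> stab_state j m'.
Proof.
case: m m' => [x y z e f] [x' y' z' e' f'] [/= xx yy zz <- <-].
have /= [a xq] := cong_dvd q_dvd1 xx; have /= [b yq] := cong_dvd q_dvd3 yy.
case: xx yy zz => [k kE] [l lE] [m mE].
have x'E : x' = x - k * p1%:Z by rewrite kE; ring.
have y'E : y' = y - l * p3%:Z by rewrite lE; ring.
have z'E : z' = z - m * q%:Z by rewrite mE; ring.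
have [->|->|->|->] := ord4_cases j; rewrite /stab_state inordK //.
- by move=> [t tE]; exists (t - k); rewrite x'E tE; ring.
- case: e => -[[t tE] [s sE]]; (split; first by exists (t - k); rewrite x'E tE; ring).
    by exists (s - m); rewrite z'E sE; ring.
  by exists (b + s - m); rewrite z'E sE; case: (f); rewrite yq; ring.
- case: f => -[[t tE] [s sE]]; (split; first by exists (t - l); rewrite y'E tE; ring).
    by exists (s - m); rewrite z'E sE; ring.
  by exists (s - m - a); rewrite z'E sE xq; ring.
- by move=> [t tE]; exists (t - l); rewrite y'E tE; ring.
Qed.

Lemma stab_state_step i j m : i <> j -> stab_state j m -> stab_state j (step i m).
Proof.
have [r1 p1E] := dvdnP q_dvd1; have [r3 p3E] := dvdnP q_dvd3.
case: m => [x y z e f].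
have [->|->|->|->] := ord4_cases i; have [->|->|->|->] := ord4_cases j => //;
  rewrite /step /stab_state !inordK //= => _.
- case: e => -[[t tE] [s sE]] /=;
    (split; first by exists (- t); rewrite tE; ring);
    by exists (- s); rewrite sE; case: (f); ring.
- case: f => -[[t tE] [s sE]] /=; (split; first by exists t);
    by exists (t * r3%:Z - s); rewrite sE tE p3E PoszM; ring.
- by move=> [t ->]; exists (- t); ring.
- by case: f => -[[t tE] [s sE]] /=; (split; first by exists t);
    exists (- s); rewrite sE; ring.
- by case: e => -[[t tE] [s sE]] /=; (split; first by exists t);
    exists (- s); rewrite sE; case: (f) => /=; ring.
- by move=> [t ->]; exists (- t); ring.
- case: e => -[[t tE] [s sE]] /=; (split; first by exists t);
  by exists (- (s + t * r1%:Z)); rewrite sE tE p1E PoszM; case: (f) => /=; ring.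
- by case: f => -[[t tE] [s sE]] /=;
    (split; first by exists (- t); rewrite tE; ring); exists (- s); rewrite sE; ring.
Qed.

End CoordinateModel.

(** * Words, exponents and counting *)

Lemma wclass_wpow (I : choiceType) (R : set (word I)) (w : word I) k :
  wclass R (wpow w k) = (wclass R w ^+ k)%g.
Proof.
elim: k => [//|k IH]; rewrite expgS -IH.
by apply/esym; exact: pmulE.
Qed.

Lemma wclass_relator (I : choiceType) (R : set (word I)) r :
  R r -> wclass R r = 1%g.
Proof.
by move=> Rr; apply/wclassP; have := weq_relator [::] [::] Rr; rewrite cats0.
Qed.

Lemma subgroup_of_letters (I : choiceType) (R : set (word I))
    (H : set (presented R)) :
    (forall i : I, wclass R [:: (i, false); (i, false)] = 1%g) ->
  is_subgroup H -> (forall i : I, H (wclass R (letter i))) -> H = setT.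
Proof.
move=> inv [H1 HV] Hg; have HM u v : H u -> H v -> H (u * v)%g.
  move=> Hu Hv; rewrite -[v]invgK; apply: (HV) => //.
  by rewrite -[(v^-1)%g]mul1g; exact: HV.
apply/seteqP; split=> // u _; elim/presentedW: u => w.
elim: w => [//|[i b] w IH]; rewrite -cat1s -pmulE; apply: HM => //.
case: b; last exact: Hg.
have -> : wclass R [:: (i, true)] = wclass R (letter i); last exact: Hg.
apply: (@mulgI _ (wclass R (letter i))).
transitivity (1%g : presented R); last first.
  by rewrite -(inv i); exact: esym (pmulE _ (letter i) (letter i)).
transitivity (wclass R [:: (i, false); (i, true)]).
  exact: pmulE _ (letter i) [:: (i, true)].
by apply/wclassP; exact: (@weq_cancel _ R [::] [::] i false).
Qed.

Lemma cong_expg (G : groupType) (u : G) p X Y :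
  (u ^+ p = 1)%g -> cong p X%:Z%R Y%:Z%R -> (u ^+ X = u ^+ Y)%g.
Proof.
move=> up [k XY].
wlog k0 : X Y k XY / (0 <= k)%R => [W|].
  have [k0|/ltW k0] := leP 0%R k; first exact: W XY k0.
  apply/esym; apply: (W _ _ (- k)%R); last by lia.
  by rewrite XY; ring.
have -> : X = (Y + p * absz k)%N by nia.
by rewrite expgnDr expgnA up expg1n mulg1.
Qed.

Lemma card_fin_type (T : finType) (U : Type) (f : T -> U) (t0 : T) :
  (forall u, exists t, f t = u) -> injective f -> [set: U] #= `I_#|T|.
Proof.
move=> f_surj f_inj.
apply: (@card_eq_enum _ _ _ (fun k => f (nth t0 (enum T) k)))
  => [//|u _|k l kT lT /f_inj].
  have [t <-] := f_surj u; exists (index t (enum T)).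
    by rewrite cardE index_mem mem_enum.
  by rewrite nth_index ?mem_enum.
rewrite cardE in kT lT.
by move=> /eqP; rewrite nth_uniq ?enum_uniq // => /eqP.
Qed.

(** * The group Gamma *)

Section GammaGroup.
Local Open Scope ring_scope.
Local Open Scope group_scope.
Variables (p1 p3 q : nat).
Hypotheses (p1_gt1 : (1 < p1)%N) (p3_gt1 : (1 < p3)%N) (q_odd : odd q).
Hypotheses (q_dvd1 : (q %| p1)%N) (q_dvd3 : (q %| p3)%N).

Local Notation p2 := q.*2.
Local Notation Gam := (Gamma p1 p2 p3).
Local Notation x := (@Gamma_gen p1 p2 p3).
Local Notation a := (x (inord 0)).
Local Notation b := (x (inord 1)).
Local Notation c := (x (inord 2)).
Local Notation d := (x (inord 3)).
Local Notation R := (Gamma_relator p1 p2 p3).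

Lemma relator_pow w k : R (wpow w k) -> wclass R w ^+ k = 1.
Proof. by move=> Rw; rewrite -wclass_wpow; exact: wclass_relator. Qed.

Lemma wclass_cat u v : wclass R (u ++ v) = wclass R u * wclass R v.
Proof. exact: esym (pmulE _ _ _). Qed.

Lemma Gamma_xx i : x i * x i = 1.
Proof. exact: relator_pow (Gamma_invol _ _ _ i). Qed.

Lemma Gamma_ab : (a * b) ^+ p1 = 1.
Proof. by have := relator_pow (Gamma_p1 p1 p2 p3); rewrite wclass_cat. Qed.

Lemma Gamma_bc : (b * c) ^+ p2 = 1.
Proof. by have := relator_pow (Gamma_p2 p1 p2 p3); rewrite wclass_cat. Qed.

Lemma Gamma_cd : (c * d) ^+ p3 = 1.
Proof. by have := relator_pow (Gamma_p3 p1 p2 p3); rewrite wclass_cat. Qed.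

Lemma invol_comm (u v : Gam) : u * u = 1 -> v * v = 1 -> (u * v) ^+ 2 = 1 ->
  u * v = v * u.
Proof.
move=> uu vv; rewrite expg2 => /mulg1_eq <-.
by rewrite invgM (mulg1_eq uu) (mulg1_eq vv).
Qed.

Lemma Gamma_x_comm (i j : 'I_4) : (i + 2 <= j)%N || (j + 2 <= i)%N ->
  x i * x j = x j * x i.
Proof.
move=> ij; apply: invol_comm; try exact: Gamma_xx.
by have := relator_pow (Gamma_comm _ _ _ ij); rewrite wclass_cat.
Qed.

Definition core_gen : Gam := b * c * b * c.
Local Notation w := core_gen.

Lemma core_genE : w = (b * c) ^+ 2.
Proof. by rewrite expg2 /w !mulgA. Qed.

Lemma core_gen_pow : w ^+ q = 1.
Proof. by rewrite core_genE -expgnA mul2n Gamma_bc. Qed.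

Lemma core_genV : w^-1 = c * b * c * b.
Proof. by rewrite /w !invgM !(invol_inv Gamma_xx) !mulgA. Qed.

(* The relations [(x0 x1 x2 x1 x2)^2 = (x3 x2 x1 x2 x1)^2 = 1] say that [x0] and
   [x3] invert [w = (x1 x2)^2], as [x1] and [x2] do; so [<w>] is normal. *)
Lemma gen_core_gen i : x i * w = w^-1 * x i.
Proof.
have xx := Gamma_xx.
have [->|->|->|->] := ord4_cases i.
- have := relator_pow (Gamma_left p1 p2 p3); rewrite !wclass_cat.
  rewrite -/(x (inord 0)) -/(x (inord 1)) -/(x (inord 2)).
  have -> : a * (b * (c * (b * c))) = a * w by rewrite /w !mulgA.
  rewrite expg2 => /mulg1_eq; rewrite invgM (invol_inv xx) => E.
  by rewrite E.
- by rewrite core_genV /w !mulgA xx mul1g -!mulgA xx mulg1.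
- by rewrite core_genV /w !mulgA.
- have := relator_pow (Gamma_right p1 p2 p3); rewrite !wclass_cat.
  rewrite -/(x (inord 3)) -/(x (inord 1)) -/(x (inord 2)).
  have -> : d * (c * (b * (c * b))) = d * w^-1 by rewrite core_genV !mulgA.
  rewrite expg2 => /mulg1_eq; rewrite invgM invgK (invol_inv xx) => E.
  by rewrite -[x _ in RHS](mulgVK w) -E -mulgA mulKg.
Qed.

Lemma core_genX i k : x i * w ^+ k = w ^+ (q.-1 * k) * x i.
Proof.
have wV : w^-1 = w ^+ q.-1.
  by apply: mulg1_eq; rewrite -expgS prednK ?core_gen_pow // odd_gt0.
elim: k => [|k IH]; first by rewrite muln0 mulg1 mul1g.
by rewrite expgSr mulgA IH -mulgA gen_core_gen wV mulgA -expgnDr mulnS addnC.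
Qed.

Lemma Gamma_gen_setT : gen_subgroup (range x) = setT.
Proof.
apply: subgroup_of_letters => [i||i].
- exact: etrans (wclass_cat (letter i) (letter i)) (Gamma_xx i).
- by split=> [|u v]; [exact: gen_subgroup1|exact: gen_subgroup_divg].
- by apply: gen_subgroup_sub; exists i.
Qed.

Lemma Gamma_ind (P : Gam -> Prop) :
  P 1 -> (forall i g, P g -> P (x i * g)) -> forall g, P g.
Proof.
move=> P1 PS g; have : gen_subgroup (range x) g by rewrite Gamma_gen_setT.
by move: g; apply: (invol_gen_ind Gamma_xx) => // i g _ _; exact: PS.
Qed.

(** The multiplier is a power of [q.-1], a sign modulo [q], and is the same for all [m]. *)
Lemma core_gen_pass g : exists j, forall m, w ^+ m * g = g * w ^+ (j * m).
Proof.
move: g; apply: Gamma_ind => [|i g [j gj]].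
  by exists 1%N => m; rewrite mulg1 mul1g mul1n.
exists (j * q.-1)%N => m.
have -> : w ^+ m * (x i * g) = x i * (w ^+ (q.-1 * m) * g).
  rewrite -[LHS](invol_mulK Gamma_xx i); congr (_ * _).
  by rewrite !mulgA core_genX -[_ * x i * x i]mulgA Gamma_xx mulg1.
by rewrite gj !mulgA mulnA.
Qed.

Definition normal_form (X : nat) (e : bool) (k Y : nat) (f : bool) : Gam :=
  (a * b) ^+ X * b ^+ e * w ^+ k * (d * c) ^+ Y * c ^+ f.

Lemma Gamma_dc : (d * c) ^+ p3 = 1.
Proof. by rewrite -invol_mul_expgV ?Gamma_xx // Gamma_cd invg1. Qed.

(** The left dihedral factor absorbs [x0] and [x1]. The letters [x2] and [x3] must cross it to reach
    the right one: this is free except when [x2] meets [x1], where [x2 x1 = x1 w x2] leaves a power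
    of [w] to be pushed right. *)
Lemma normal_form_exists g : exists X e k Y f, g = normal_form X e k Y f.
Proof.
have xx := Gamma_xx.
suff [u [k [v [uA vD ->]]]] : exists u k v,
    [/\ gen_subgroup (x @` [set inord 0; inord 1]) u,
        gen_subgroup (x @` [set inord 3; inord 2]) v & g = u * w ^+ k * v].
  have [X [e ->]] := dihedral_form xx (ltnW p1_gt1) Gamma_ab uA.
  have [Y [f ->]] := dihedral_form xx (ltnW p3_gt1) Gamma_dc vD.
  by exists X, e, k, Y, f; rewrite /normal_form !mulgA.
move: g; apply: Gamma_ind => [|i g [u [k [v [uA vD ->]]]]].
  by exists 1, 0%N, 1; rewrite !mulg1; split=> //; exact: gen_subgroup1.
have [iA|] := pselect ([set inord 0; inord 1] i).
  exists (x i * u), k, v; rewrite !mulgA; split=> //.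
  by apply: gen_subgroupM => //; apply: gen_subgroup_sub; exists i.
have [iD _|iD iA] := pselect ([set inord 3; inord 2] i); last first.
  by have [] := ord4_cases i => E; exfalso;
    [apply: iA; left|apply: iA; right|apply: iD; right|apply: iD; left].
suff [j uj] : exists j, x i * u = u * w ^+ j * x i.
  exists u, (j + q.-1 * k)%N, (x i * v); split=> //.
    by apply: gen_subgroupM => //; apply: gen_subgroup_sub; exists i.
  by rewrite !mulgA uj -[u * w ^+ j * _ * _]mulgA core_genX expgnDr !mulgA.
case: iD => ->.
  exists 0%N; rewrite mulg1; move: u uA.
  apply: (invol_gen_ind xx); first by rewrite mulg1 mul1g.
  move=> l u lA _ IH; rewrite mulgA Gamma_x_comm; last first.
    by case: lA => ->; rewrite !inordK.
  by rewrite -mulgA IH mulgA.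
move: u uA; apply: (invol_gen_ind xx).
  by exists 0%N; rewrite !mulg1 mul1g.
move=> l u [->|->] _ [j uj].
  exists j; rewrite mulgA Gamma_x_comm; last by rewrite !inordK.
  by rewrite -mulgA uj !mulgA.
have [j' pass] := core_gen_pass u.
exists (j' * 1 + j)%N; have -> : c * (b * u) = b * (w ^+ 1 * (c * u)).
  by rewrite expg1 /w !mulgA xx mul1g -[_ * c * c]mulgA xx mulg1.
by rewrite uj 2![w ^+ 1 * (_ * _)]mulgA pass expgnDr !mulgA.
Qed.

(** * Coordinates of the elements of [Gamma] *)

Local Notation base := base_state.
Local Notation state_cong := (state_eq p1 p3 q).

Definition coord (g : Gam) : state := act (repr g) base.

Lemma coord_wclass u m g : state_cong (coord g) m ->
  state_cong (coord (wclass R u * g)) (act u m).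
Proof.
move=> gm; have -> : wclass R u * g = wclass R (u ++ repr g).
  by rewrite wclass_cat; congr (_ * _); exact: esym (reprK g).
apply: state_eq_trans (act_eq q_dvd1 q_dvd3 u gm); rewrite -act_cat.
exact: (act_weq q_dvd1 q_dvd3 (erefl p2) (weq_repr R (u ++ repr g)) base).
Qed.

Lemma coord_wclassX u k m g :
  state_cong (coord g) m ->
  state_cong (coord (wclass R u ^+ k * g)) (iter k (act u) m).
Proof.
move=> gm; elim: k => [|k IH]; first by rewrite mul1g.
by rewrite expgS -mulgA iterS; exact: coord_wclass.
Qed.

Lemma coord1 : state_cong (coord 1) base.
Proof. exact: (act_weq q_dvd1 q_dvd3 (erefl p2) (weq_repr R [::]) base). Qed.

Lemma coord_gen i g : state_cong (coord (x i * g)) (step i (coord g)).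
Proof. exact: (@coord_wclass (letter i) _ _ (state_eq_refl _ _ _ _)). Qed.

(** Reading the normal form from the right, the third coordinate collects [-f] from [x2^f], [Y] from
    [(x3 x2)^Y], [2 k] from [w^k], a sign from [x1^e], and [X (Y - 1)] from [(x0 x1)^X]. *)
Lemma coord_normal_form X (e : bool) k Y (f : bool) :
  state_cong (coord (normal_form X e k Y f)) (State X%:Z Y%:Z
    ((if e then -1 else 1) * (Y%:Z - (f : nat)%:Z + 2 * k%:Z)
      + X%:Z * (Y%:Z - 1))%R e f).
Proof.
have -> : normal_form X e k Y f = wclass R (xw 0 ++ xw 1) ^+ X *
  (wclass R (xw 1) ^+ e * (wclass R (xw 1 ++ xw 2) ^+ k.*2 *
  (wclass R (xw 3 ++ xw 2) ^+ Y * (wclass R (xw 2) ^+ f * 1)))).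
  by rewrite !wclass_cat /normal_form -[k.*2]mul2n expgnA -core_genE !mulgA mulg1.
have := coord_wclassX (xw 2) f coord1.
move=> /(coord_wclassX (xw 3 ++ xw 2) Y) /(coord_wclassX (xw 1 ++ xw 2) k.*2).
move=> /(coord_wclassX (xw 1) e) /(coord_wclassX (xw 0 ++ xw 1) X).
rewrite iter_step01 iter_step12 iter_step32.
have fE : iter f (act (xw 2)) base = State 0 0 (- (f : nat)%:Z)%R false f.
  by case: f; rewrite //= /step inordK //=.
have eE m : iter e (act (xw 1)) m = State ((if e then -1 else 1) * sx m)%R (sy m)
    ((if e then -1 else 1) * sz m)%R (e (+) se m) (sf m).
  case: m => x' y z e' f'; case: (e);
    by rewrite /= ?/step ?inordK //= ?addTb; congr State; ring.
rewrite fE eE /= addbF.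
by move=> nf; apply: (state_eq_trans nf); split=> //=; exists 0%R; ring.
Qed.

Lemma stab_coord j g : stab x j g -> stab_state p1 p3 q j (coord g).
Proof.
move: g; apply: (invol_gen_ind Gamma_xx).
  exact: stab_state_eq (state_eq_sym coord1) (stab_state_base _ _ _ j).
move=> i g ij _ sg.
apply: (stab_state_eq q_dvd1 q_dvd3 (state_eq_sym (coord_gen i g))).
exact: (stab_state_step q_dvd1 q_dvd3 ij).
Qed.

Lemma stab_normal_form j X (e : bool) k Y (f : bool) :
  stab x j (normal_form X e k Y f) ->
  stab_state p1 p3 q j (State X%:Z Y%:Z
    ((if e then -1 else 1) * (Y%:Z - (f : nat)%:Z + 2 * k%:Z)
      + X%:Z * (Y%:Z - 1))%R e f).
Proof.
by move=> /stab_coord; apply: stab_state_eq => //; exact: coord_normal_form.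
Qed.

Lemma core_gen_trivial k : cong q (2 * k%:Z)%R 0 -> w ^+ k = 1.
Proof.
move=> [t tE]; rewrite -[1](expg0 w); apply: cong_expg core_gen_pow _.
have := odd_double_half q; rewrite q_odd => qE.
(* With [q = 1 + 2 h] and [2 k = t q], one gets [k = k q - 2 k h = (k - t h) q]. *)
by exists (k%:Z - t * (q./2)%:Z)%R; nia.
Qed.

Lemma cong01F p : (1 < p)%N -> ~ cong p 0 1.
Proof.
move=> p_gt1 [t tE]; have /(congr1 absz) : (t * p%:Z = -1)%R by lia.
by rewrite abszM => /eqP; rewrite muln_eq1 => /andP [_ /eqP]; lia.
Qed.

Lemma cong_sym p u v : cong p u v -> cong p v u.
Proof. by move=> [k ->]; exists (- k)%R; ring. Qed.

Lemma cong_trans p u v z : cong p u v -> cong p v z -> cong p u z.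
Proof. by move=> [k ->] [l ->]; exists (k + l)%R; ring. Qed.

Lemma Gamma_sc_notin i : ~ stab x i (x i).
Proof.
move=> /stab_coord xi.
have {xi} : stab_state p1 p3 q i (step i base).
  apply: (stab_state_eq q_dvd1 q_dvd3 _ xi).
  apply: (state_eq_trans _ (step_eq q_dvd1 q_dvd3 i coord1)).
  by rewrite -[x i]mulg1; exact: coord_gen.
have [->|->|->|->] := ord4_cases i; rewrite /step /stab_state !inordK //=.
- by rewrite subr0 => /cong_sym /(cong01F p1_gt1).
- by move=> [/(cong01F p1_gt1)].
- by rewrite oppr0 => -[/(cong01F p3_gt1)].
- by rewrite subr0 => /cong_sym /(cong01F p3_gt1).
Qed.

(** * Normal forms lying in the subgroups [stab] *)

Section NormalForm.
Variables (X : nat) (e : bool) (k Y : nat) (f : bool).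
Local Notation nf := (normal_form X e k Y f).

Lemma normal_form_stab0 : stab x (inord 0) nf -> (a * b) ^+ X = 1.
Proof.
move=> /stab_normal_form; rewrite /stab_state inordK //.
exact: (@cong_expg _ _ _ X 0 Gamma_ab).
Qed.

Lemma normal_form_stab3 : stab x (inord 3) nf -> (d * c) ^+ Y = 1.
Proof.
move=> /stab_normal_form; rewrite /stab_state inordK //.
exact: (@cong_expg _ _ _ Y 0 Gamma_dc).
Qed.

(** Once [X] is [e] modulo [p1], the terms in [Y] and [f] cancel from the congruence on the third
    coordinate, leaving [2 k = 0] modulo [q] up to sign. *)
Lemma normal_form_stab1 :
  stab x (inord 1) nf -> (a * b) ^+ X = (a * b) ^+ e /\ w ^+ k = 1.
Proof.
have [r1 p1E] := dvdnP q_dvd1.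
move=> /stab_normal_form; rewrite /stab_state inordK // => XZ.
(* The four cases on [e] and [f] in [stab_state], merged into one pair of congruences. *)
have [[u uE] [s sE]] : cong p1 X%:Z (e : nat)%:Z /\
    cong q ((if e then -1 else 1) * (Y%:Z - (f : nat)%:Z + 2 * k%:Z)
      + X%:Z * (Y%:Z - 1))%R
     (if e then (f : nat)%:Z - 1 else Y%:Z - (f : nat)%:Z)%R.
  by case: (e) XZ => -[XE ZE]; split=> //; case: (f) ZE => //=; rewrite subr0.
split; first by apply: (cong_expg Gamma_ab); exists u.
apply: core_gen_trivial.
exists ((if e then -1 else 1) * (s - u * r1%:Z * (Y%:Z - 1)))%R.
by move: sE; rewrite uE p1E !PoszM; case: (e) => /=; lia.
Qed.

Lemma normal_form_stab2 :
  stab x (inord 2) nf -> (d * c) ^+ Y = (d * c) ^+ f /\ w ^+ k = 1.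
Proof.
have [r3 p3E] := dvdnP q_dvd3.
move=> /stab_normal_form; rewrite /stab_state inordK // => YZ.
have [[v vE] [s sE]] : cong p3 Y%:Z (f : nat)%:Z /\
    cong q ((if e then -1 else 1) * (Y%:Z - (f : nat)%:Z + 2 * k%:Z)
      + X%:Z * (Y%:Z - 1))%R
     (X%:Z * ((f : nat)%:Z - 1))%R.
  case: (f) YZ => -[YE ZE]; split=> //; first by rewrite subrr mulr0.
  by rewrite sub0r mulrN1.
split; first by apply: (cong_expg Gamma_dc); exists v.
apply: core_gen_trivial.
exists ((if e then -1 else 1) * (s - X%:Z * v * r3%:Z) - v * r3%:Z)%R.
by move: sE; rewrite vE p3E !PoszM; case: (e) => /=; lia.
Qed.

Lemma normal_form_stab01 :
  stab x (inord 0) nf -> stab x (inord 1) nf -> e = false.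
Proof.
move=> /stab_normal_form + /stab_normal_form; rewrite /stab_state !inordK //.
move=> X0; case: (e) => // -[X1 _].
by case: (cong01F p1_gt1 (cong_trans (cong_sym X0) X1)).
Qed.

Lemma normal_form_stab23 :
  stab x (inord 2) nf -> stab x (inord 3) nf -> f = false.
Proof.
move=> /stab_normal_form + /stab_normal_form; rewrite /stab_state !inordK //.
move=> Y2 Y0; move: Y2; case: (f) => // -[Y1 _].
by case: (cong01F p3_gt1 (cong_trans (cong_sym Y0) Y1)).
Qed.

End NormalForm.

(** Each of the two memberships kills some factors of the normal form or shrinks them to single
    reflections; for each of the six pairs, what survives is visibly a word in the two remaining
    generators. *)
Lemma Gamma_sc_inter (i j : 'I_4) : (i < j)%N ->
  stab x i `&` stab x j `<=` gen_subgroup (x @` [set k | k <> i /\ k <> j]).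
Proof.
move=> ij g [].
have [X [e [k [Y [f ->]]]]] := normal_form_exists g => iP jP.
pose S := gen_subgroup (x @` [set k | k <> i /\ k <> j]).
have Sx (l : 'I_4) : (l : nat) != i -> (l : nat) != j -> S (x l).
  by move=> li lj; apply: gen_subgroup_sub; exists l => //; split=> E;
    [move: li|move: lj]; rewrite E eqxx.
have SM u v : S u -> S v -> S (u * v) by exact: gen_subgroupM.
have SX u m : S u -> S (u ^+ m) by exact: gen_subgroupX.
have Eab : (a * b) ^+ e * b ^+ e = a ^+ e.
  by case: (e); rewrite /= ?mulg1 // !expg1 -mulgA Gamma_xx mulg1.
have Edc : (d * c) ^+ f * c ^+ f = d ^+ f.
  by case: (f); rewrite /= ?mulg1 // !expg1 -mulgA Gamma_xx mulg1.
rewrite -/S; clearbody S; move: ij iP jP Sx.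
have [->|->|->|->] := ord4_cases i; have [->|->|->|->] := ord4_cases j;
  rewrite !inordK // => _ iP jP Sx.
- have e0 := normal_form_stab01 iP jP; have [_ wk] := normal_form_stab1 jP.
  rewrite /normal_form wk (normal_form_stab0 iP) e0 !mul1g.
  by apply: (SM); apply: (SX); [apply: (SM)|]; apply: (Sx); rewrite inordK.
- have [dcY wk] := normal_form_stab2 jP.
  rewrite /normal_form dcY wk (normal_form_stab0 iP) mul1g mulg1 -mulgA Edc.
  by apply: (SM); apply: (SX); apply: (Sx); rewrite inordK.
- rewrite /normal_form (normal_form_stab0 iP) (normal_form_stab3 jP).
  rewrite mul1g mulg1 core_genE.
  have Sbc : S (b * c) by apply: (SM); apply: (Sx); rewrite inordK.
  have Sb : S b by apply: (Sx); rewrite inordK.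
  have Sc : S c by apply: (Sx); rewrite inordK.
  by apply: (SM); [apply: (SM)|]; do ?[apply: (SX)].
- have [dcY wk] := normal_form_stab2 jP; have [abX _] := normal_form_stab1 iP.
  rewrite /normal_form dcY wk abX Eab mulg1 -mulgA Edc.
  by apply: (SM); apply: (SX); apply: (Sx); rewrite inordK.
- have [abX wk] := normal_form_stab1 iP.
  rewrite /normal_form abX wk (normal_form_stab3 jP) Eab !mulg1.
  by apply: (SM); apply: (SX); apply: (Sx); rewrite inordK.
- have f0 := normal_form_stab23 iP jP; have [_ wk] := normal_form_stab2 iP.
  rewrite /normal_form wk (normal_form_stab3 jP) f0 !mulg1.
  by apply: (SM); apply: (SX); [apply: (SM)|]; apply: (Sx); rewrite inordK.
Qed.

Lemma Gamma_string_C_group : string_C_group x.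
Proof.
split.
- exact: Gamma_xx.
- by move=> i j ij; apply: Gamma_x_comm; rewrite addn2 ij.
- exact: Gamma_gen_setT.
- exact: Gamma_sc_inter.
- exact: Gamma_sc_notin.
- move=> g; have [X [e [k [Y [f ->]]]]] := normal_form_exists g => gP.
  have [_ wk] := normal_form_stab1 (gP _).
  have e0 := normal_form_stab01 (gP _) (gP _).
  have f0 := normal_form_stab23 (gP _) (gP _).
  rewrite /normal_form (normal_form_stab0 (gP _)) (normal_form_stab3 (gP _)).
  by rewrite wk e0 f0 !mulg1.
Qed.

(** * Orders of the rotations, order of [Gamma], orientation character *)

Lemma Gamma_order_ab k : stab x (inord 0) ((a * b) ^+ k) -> (p1 %| k)%N.
Proof.
have -> : (a * b) ^+ k = normal_form k false 0 0 false by rewrite /normal_form !mulg1.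
move=> /stab_normal_form; rewrite /stab_state inordK // => -[t]; rewrite add0r.
by move=> /(congr1 absz); rewrite abszM /= => ->; exact: dvdn_mull.
Qed.

Lemma Gamma_order_bc k : stab x (inord 1) ((b * c) ^+ k) -> (p2 %| k)%N.
Proof.
have kE := odd_double_half k.
have wE : (b * c) ^+ (k./2).*2 = w ^+ k./2 by rewrite core_genE -expgnA mul2n.
(* For odd [k] the normal form has [X = 0] and [e = true], while membership would force [X = 1]
   modulo [p1]. For even [k] only a power of [w] remains, and 2 is cancelled modulo [q]. *)
rewrite -{1}kE; case: (odd k) kE => kE.
  have -> : (b * c) ^+ (true + k./2.*2) =
      normal_form 0 true (q.-1 * k./2) 0 true.
    rewrite /normal_form mul1g mulg1 expgnDr wE !expg1 -mulgA core_genX.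
    by rewrite mulgA.
  move=> /stab_normal_form; rewrite /stab_state inordK // => -[X1 _].
  by case: (cong01F p1_gt1 X1).
rewrite add0n wE.
have -> : w ^+ k./2 = normal_form 0 false k./2 0 false.
  by rewrite /normal_form !mulg1 mul1g.
move=> /stab_normal_form; rewrite /stab_state inordK // => -[_ [t /= tE]].
have : (q %| 2 * k./2)%N by apply/dvdnP; exists (absz t); nia.
rewrite Gauss_dvdr ?coprimen2 // => qk.
by rewrite -[k]kE add0n -!mul2n dvdn_pmul2l.
Qed.

Lemma Gamma_order_cd k : stab x (inord 2) ((c * d) ^+ k) -> (p3 %| k)%N.
Proof.
rewrite -[(c * d) ^+ k]invgK invol_mul_expgV ?Gamma_xx // => /gen_subgroupV.
rewrite invgK.
have -> : (d * c) ^+ k = normal_form 0 false 0 k false.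
  by rewrite /normal_form !mulg1 !mul1g.
move=> /stab_normal_form; rewrite /stab_state inordK // => -[[t] + _]; rewrite add0r.
by move=> /(congr1 absz); rewrite abszM /= => ->; exact: dvdn_mull.
Qed.

Lemma cong_small p (u v : nat) : (u < p)%N -> (v < p)%N ->
  cong p u%:Z v%:Z -> u = v.
Proof.
move=> up vp [t tE]; have [t0|t0] := eqVneq t 0%R; first by rewrite t0 in tE; lia.
by nia.
Qed.

Lemma Gamma_card : [set: Gam] #= `I_(2 * p1 * p2 * p3).
Proof.
pose F (t : 'I_p1 * bool * 'I_q * 'I_p3 * bool) : Gam :=
  let: (X, e, k, Y, f) := t in normal_form X e k Y f.
have q_gt0 : (0 < q)%N by rewrite odd_gt0.
have -> : (2 * p1 * p2 * p3)%N = #|{: 'I_p1 * bool * 'I_q * 'I_p3 * bool}|.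
  by rewrite !card_prod !card_ord card_bool -muln2; ring.
have p1_gt0 := ltnW p1_gt1; have p3_gt0 := ltnW p3_gt1.
apply: (@card_fin_type _ _ F
  (Ordinal p1_gt0, false, Ordinal q_gt0, Ordinal p3_gt0, false)).
  move=> g; have [X [e [k [Y [f ->]]]]] := normal_form_exists g.
  have Xp : (X %% p1 < p1)%N by rewrite ltn_mod.
  have kq : (k %% q < q)%N by rewrite ltn_mod.
  have Yp : (Y %% p3 < p3)%N by rewrite ltn_mod.
  exists (Ordinal Xp, e, Ordinal kq, Ordinal Yp, f); rewrite /F /normal_form /=.
  by rewrite !expg_modn ?Gamma_ab ?Gamma_dc ?core_gen_pow.
move=> [[[[X e] k] Y] f] [[[[X' e'] k'] Y'] f'] FE.
have E := coord_normal_form X e k Y f.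
have E' := coord_normal_form X' e' k' Y' f'.
rewrite -[normal_form X e k Y f]/(F (X, e, k, Y, f)) FE in E.
have [/= XX YY + ee ff] := state_eq_trans (state_eq_sym E) E'.
have {}XX := ord_inj (cong_small (ltn_ord X) (ltn_ord X') XX).
have {}YY := ord_inj (cong_small (ltn_ord Y) (ltn_ord Y') YY).
subst X' Y' e' f' => -[t tE]; have kk : k = k'.
  apply/ord_inj/(cong_small (ltn_ord k) (ltn_ord k')).
  have := odd_double_half q; rewrite q_odd => qE.
  (* Halving modulo [q] as in [core_gen_trivial], now from [2 (k - k') = t q] up to sign. *)
  exists ((k : nat)%:Z - (k' : nat)%:Z -
    (if e then -1 else 1) * t * (q./2)%:Z)%R.
  by move: tE; case: (e) => /=; nia.
by rewrite kk.
Qed.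

(** Each generator flips exactly one of the two bits, so their sum is the parity of word length. *)
Definition Gamma_sign (g : Gam) : bool := se (coord g) (+) sf (coord g).

Lemma Gamma_sign1 : Gamma_sign 1 = false.
Proof. by rewrite /Gamma_sign; have [_ _ _ -> ->] := coord1. Qed.

Lemma Gamma_signM i g : Gamma_sign (x i * g) = ~~ Gamma_sign g.
Proof.
rewrite /Gamma_sign; have [_ _ _ -> ->] := coord_gen i g.
by case: (coord g) => ? ? ? e f; have [->|->|->|->] := ord4_cases i;
  rewrite /step inordK //= ?addNb ?addbN.
Qed.

Lemma Gamma_polytope :
  [/\ is_polytope (@coset_poset_le p1 p2 p3) (@coset_poset_rk p1 p2 p3) 4,
      has_type3 (@coset_poset_le p1 p2 p3) (@coset_poset_rk p1 p2 p3) p1 p2 p3,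
      is_tight3 (@coset_poset_le p1 p2 p3) p1 p2 p3
    & is_orientably_regular (@coset_poset_le p1 p2 p3) (@coset_poset_rk p1 p2 p3) 4].
Proof.
have C := Gamma_string_C_group; split.
- exact: coset_poset_is_polytope C.
- split=> F H FH rF rH.
  + apply: (@section_is_polygon _ _ _ C F H (inord 0) (inord 1)) => //;
      rewrite ?inordK //; [exact: ltnW|exact: Gamma_ab|exact: Gamma_order_ab].
  + apply: (@section_is_polygon _ _ _ C F H (inord 1) (inord 2)) => //;
      rewrite ?inordK //; 
      [by rewrite double_gt0 odd_gt0|exact: Gamma_bc|exact: Gamma_order_bc].
  + apply: (@section_is_polygon _ _ _ C F H (inord 2) (inord 3)) => //;
      rewrite ?inordK //; [exact: ltnW|exact: Gamma_cd|exact: Gamma_order_cd].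
- exact: flag_card C _ Gamma_card.
- exact: (coset_poset_orientably_regular C (inord 0) Gamma_sign1 Gamma_signM).
Qed.

End GammaGroup.

Theorem theorem4p11 (p1 p2 p3 : nat) (p1_gt1 : 1 < p1) (p3_gt1 : 1 < p3)
    (p1_odd : odd p1) (p3_odd : odd p3) (p2_even : ~~ odd p2)
    (p2_dvd1 : p2 %| 2 * p1) (p2_dvd3 : p2 %| 2 * p3) :
  [/\ is_polytope (@coset_poset_le p1 p2 p3) (@coset_poset_rk p1 p2 p3) 4,
      has_type3 (@coset_poset_le p1 p2 p3) (@coset_poset_rk p1 p2 p3) p1 p2 p3,
      is_tight3 (@coset_poset_le p1 p2 p3) p1 p2 p3
    & is_orientably_regular (@coset_poset_le p1 p2 p3) (@coset_poset_rk p1 p2 p3) 4].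
Proof.
rewrite -(even_halfK p2_even) in p2_dvd1 p2_dvd3 *.
rewrite -mul2n dvdn_pmul2l // in p2_dvd1.
rewrite -mul2n dvdn_pmul2l // in p2_dvd3.
by apply: Gamma_polytope => //; exact: dvdn_odd p2_dvd1 p1_odd.
Qed.
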